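(* The anti-forcing spectrum of an even polygonal chain $G$ is continuous; that is, the set $\mathrm{Spec}_{af}(G)=\{af(G,M): M \text{ is a perfect matching of } G\}$ is a set of consecutive integers (an integer interval).
   Context: All graphs are finite and simple. For a perfect matching $M$ of $G$, a set $S\subseteq E(G)\setminus M$ is an anti-forcing set of $M$ if $M$ is the unique perfect matching of $G-S$; $af(G,M)$ is the minimum cardinality of an anti-forcing set of $M$. A connected plane graph is outerplane if all its vertices lie on the boundary of the exterior face. A face cycle is the boundary of an interior face when it is a cycle; two face cycles are adjacent if they share an edge. An even polygonal chain is a 2-connected plane bipartite graph that is outerplane and in which each face cycle is adjacent to at most two other face cycles. *)

(* Defs.v *)
From mathcomp Require Import all_boot all_fingroup.

Set Implicit Arguments.
Unset Strict Implicit.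
Unset Printing Implicit Defensive.

Record sgraph := SGraph {
  vertex :> finType;
  adj : rel vertex;
  adj_sym : symmetric adj;
  adj_irrefl : irreflexive adj }.

Definition edges (G : sgraph) : {set {set G}} :=
  [set [set p.1; p.2] | p : G * G & adj p.1 p.2].

Definition connected (G : sgraph) : Prop := forall x y : G, connect (@adj G) x y.

(* More than two vertices, connected, and no cut vertex. *)
Definition two_connected (G : sgraph) : Prop :=
  [/\ 2 < #|G|, connected G &
      forall v x y : G, x != v -> y != v ->
        connect [rel a b | [&& adj a b, a != v & b != v]] x y].

Definition bipartite (G : sgraph) : Prop :=
  exists c : G -> bool, forall x y : G, adj x y -> c x != c y.

(* Plane graphs are encoded as combinatorial maps. A dart is an edge with an
   orientation; it is identified with the ordered pair (source, target). *)
Definition dart (G : sgraph) : finType := {p : G * G | adj p.1 p.2}.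

Definition source (G : sgraph) (d : dart G) : G := (val d).1.
Definition target (G : sgraph) (d : dart G) : G := (val d).2.

Lemma dart_rev_proof (G : sgraph) (d : dart G) : adj (target d) (source d).
Proof. by rewrite adj_sym (valP d). Qed.

Definition dart_rev (G : sgraph) (d : dart G) : dart G :=
  exist (fun p : G * G => adj p.1 p.2) (target d, source d) (dart_rev_proof d).

Lemma dart_rev_inj (G : sgraph) : injective (@dart_rev G).
Proof.
move=> d d' /(congr1 val) [ht hs]; apply/val_inj.
by rewrite [val d]surjective_pairing [val d']surjective_pairing; congr (_, _).
Qed.

Definition dart_edge (G : sgraph) (d : dart G) : {set G} :=
  [set source d; target d].

(* A rotation system: around each vertex, the darts leaving that vertex are
   permuted in a single cycle (their cyclic order in the drawing). *)
Definition rotation_system (G : sgraph) (rot : {perm dart G}) : Prop :=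
  forall d d' : dart G, (d' \in porbit rot d) = (source d' == source d).

(* Walking along the boundary of a face: traverse the dart d, then leave its
   target by the dart that follows the reverse of d in the rotation. *)
Definition face_perm (G : sgraph) (rot : {perm dart G}) : {perm dart G} :=
  (perm (@dart_rev_inj G) * rot)%g.

(* A face is given by the set of darts of its boundary walk. *)
Definition faces (G : sgraph) (rot : {perm dart G}) : {set {set dart G}} :=
  porbits (face_perm rot).

(* A connected plane graph (with at least one edge). The drawing lies in the
   plane exactly when the map has genus 0, which for a connected graph is
   Euler's formula; pg_outer is the exterior face. *)
Record plane_graph := PlaneGraph {
  pg_graph :> sgraph;
  pg_rot : {perm dart pg_graph};
  pg_outer : {set dart pg_graph};
  pg_connected : connected pg_graph;
  pg_rotation : rotation_system pg_rot;
  pg_euler : #|pg_graph| + #|faces pg_rot| = #|edges pg_graph| + 2;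
  pg_outer_face : pg_outer \in faces pg_rot }.

Definition outerplane (G : plane_graph) : Prop :=
  forall v : G, exists2 d, d \in pg_outer G & source d = v.

Definition face_boundary (G : sgraph) (F : {set dart G}) : {set {set G}} :=
  [set dart_edge d | d in F].

(* The closed walk around the face F is a cycle when it has length at least 3
   and repeats no vertex. *)
Definition bounded_by_cycle (G : sgraph) (F : {set dart G}) : bool :=
  (2 < #|F|) && [forall d in F, forall d' in F, (source d == source d') ==> (d == d')].

(* Face cycles, each given by its set of edges. *)
Definition face_cycles (G : plane_graph) : {set {set {set G}}} :=
  [set face_boundary F | F in faces (pg_rot G) & (F != pg_outer G) && bounded_by_cycle F].

Definition adjacent_cycles (T : finType) (C C' : {set {set T}}) : bool :=
  C :&: C' != set0.

Definition even_polygonal_chain (G : plane_graph) : Prop :=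
  [/\ two_connected G, bipartite G, outerplane G &
      forall C, C \in face_cycles G ->
        #|[set C' in face_cycles G | (C' != C) && adjacent_cycles C C']| <= 2].

(* M is a perfect matching of the graph with vertex set T and edge set E. *)
Definition perfect_matching (T : finType) (E M : {set {set T}}) : bool :=
  (M \subset E) && [forall v, #|[set e in M | v \in e]| == 1].

Definition anti_forcing_set (G : sgraph) (M S : {set {set G}}) : bool :=
  (S \subset edges G :\: M) &&
  [forall M', perfect_matching (edges G :\: S) M' == (M' == M)].

(* Meaningful when M is a perfect matching of G: then edges G :\: M is an
   anti-forcing set of M (anti_forcing_setC), so the minimum exists. *)
Definition af (G : sgraph) (M : {set {set G}}) : nat :=
  #|[arg min_(S < edges G :\: M | anti_forcing_set M S) #|S|]|.

Definition af_spectrum (G : sgraph) : pred nat :=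
  [pred n | [exists M : {set {set G}}, perfect_matching (edges G) M && (af M == n)]].

Lemma anti_forcing_setC (G : sgraph) (M : {set {set G}}) :
  perfect_matching (edges G) M -> anti_forcing_set M (edges G :\: M).
Proof.
case/andP=> sME /forallP pM; rewrite /anti_forcing_set subxx /=.
have -> : edges G :\: (edges G :\: M) = M by rewrite setDDr setDv set0U; apply/setIidPr.
apply/forallP=> M'; apply/eqP; apply/idP/eqP => [|->]; last first.
  by rewrite /perfect_matching subxx; apply/forallP.
case/andP=> sM'M /forallP pM'; apply/eqP; rewrite eqEsubset sM'M /=.
apply/subsetP=> e eM; have /imsetP[p _ ep] := subsetP sME _ eM.
have pe : p.1 \in e by rewrite ep set21.
have /cards1P[f' Ef'] := pM' p.1; have /cards1P[f Ef] := pM p.1.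
have := set11 f'; rewrite -Ef' inE => /andP[f'M' pf'].
have : f' \in [set e in M | p.1 \in e] by rewrite inE (subsetP sM'M).
have : e \in [set e in M | p.1 \in e] by rewrite inE eM.
by rewrite Ef !inE => /eqP-> /eqP <-.
Qed.

(* Main.v *)
(* By Euler's formula and linear algebra over F_2, every set of edges with even
   degrees is a sum of face boundaries. In a 2-connected outerplane graph this
   makes the exterior face a Hamilton cycle and the inner dual a connected graph
   with one edge less than vertices, hence a path F_0, ..., F_N for a polygonal
   chain. Relative to a fixed perfect matching, perfect matchings are then words
   with one bit per face, a change of letter being allowed in only one
   direction at each chord, and matching that chord.

   An anti-forcing set of a matching must hit its symmetric differences with all
   the other perfect matchings. Its minimal size is computed by a
   left-to-right greedy automaton with two counters. The sets of values
   reachable in each state of the automaton stay intervals, and stay close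
   enough to each other for their unions to be intervals too. *)
Require Import Defs.
From mathcomp Require Import all_boot all_fingroup.
From mathcomp Require Import all_algebra zify.

Set Implicit Arguments.
Unset Strict Implicit.
Unset Printing Implicit Defensive.

(** * Words and hitting sets *)

(** All edges at one position belong to the same sums of face boundaries, so only the set of
    positions met by an anti-forcing set matters, and a position is available as soon as it carries
    an unmatched edge. The obstacle is a face all of whose exterior edges are matched: it offers no
    such edge, and the price of hitting everything still open after it can rise from one to two.
    Such a face lies between chords of different signs, and its letter disagrees with the sign of
    the next chord; this keeps the second counter at most 2. Being an interval is too weak a
    property for an induction over the faces, because the values split by letter and by counter, and
    some of these sets may be empty. The record [staircase] adds the inclusions and the nearness
    that make it stable under the three possible successions of chord signs: equal, different, and
    different around a face without unmatched exterior edge. *)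

(* Position [k.*2] stands for the exterior edges of the face [k], position
   [k.*2.+1] for the chord between the faces [k] and [k.+1]; [face_sum h] is
   the sum modulo 2 of the boundaries of the faces in [h]. *)
Definition face_sum (h : nat -> bool) (p : nat) : bool :=
  if odd p then h p./2 (+) h p./2.+1 else h p./2.

Lemma face_sum_even h k : face_sum h k.*2 = h k.
Proof. by rewrite /face_sum odd_double doubleK. Qed.

Lemma face_sum_odd h k : face_sum h k.*2.+1 = h k (+) h k.+1.
Proof. by rewrite /face_sum /= odd_double /= uphalf_double. Qed.

Lemma eq_face_sum h h' p :
  (forall j, j <= uphalf p -> h j = h' j) -> face_sum h p = face_sum h' p.
Proof.
rewrite uphalf_half /face_sum; case: odd => eqh; first by rewrite !eqh.
by rewrite eqh.
Qed.

Lemma face_sum0 p : face_sum (fun=> false) p = false.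
Proof. by rewrite /face_sum if_same. Qed.

(** * Intervals of weights and their unions *)

Definition convex (X : nat -> Prop) : Prop :=
  forall x y t, X x -> X y -> x <= t <= y -> X t.

Definition union (X Y : nat -> Prop) : nat -> Prop := fun v => X v \/ Y v.

Definition shift (X : nat -> Prop) : nat -> Prop := fun v => exists2 u, X u & v = u.+1.

(** Distance at most one is what two intervals need for their union to be an interval, even if they
    are disjoint. *)
Definition near_sets (X Y : nat -> Prop) : Prop :=
  exists x y, [/\ X x, Y y & x <= y.+1 /\ y <= x.+1].

Lemma eq_convex X Y : (forall v, X v <-> Y v) -> convex X -> convex Y.
Proof. by move=> E cX x y t /E Xx /E Xy /(cX _ _ _ Xx Xy)/E. Qed.

Lemma convex_shift X : convex X -> convex (shift X).
Proof.
move=> cX _ _ t [x Xx ->] [y Xy ->] /andP[lt1 lt2].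
by exists t.-1; [apply: (cX x y)|]; move=> //; lia.
Qed.

(** A number between a point of [X] and a point of [Y] lies on one side of a near pair, hence in one
    of the two sets. Nearness is asked only if [X] is inhabited, since sets such as [F] and [p0] may
    be empty. *)
Lemma convex_union X Y : convex X -> convex Y -> (forall x, X x -> near_sets X Y) ->
  convex (union X Y).
Proof.
move=> cX cY nXY.
have mix u w t : X u -> Y w -> (u <= t <= w) || (w <= t <= u) -> union X Y t.
  move=> Xu Yw; case: (nXY u Xu) => x [y [Xx Yy [lexy leyx]]].
  case/orP=> /andP[l1 l2].
  - have [l3|l3] := leqP t x; first by left; apply: (cX u x); rewrite ?l1.
    by right; apply: (cY y w); rewrite ?l2 ?andbT // (leq_trans leyx).
  - have [l3|l3] := leqP t y; first by right; apply: (cY w y); rewrite ?l1.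
    by left; apply: (cX x u); rewrite ?l2 ?andbT // (leq_trans lexy).
move=> x y t [Xx|Yx] [Xy|Yy] l.
- by left; apply: (cX x y).
- by apply: (mix x y); rewrite ?l.
- by apply: (mix y x); rewrite ?l ?orbT.
- by right; apply: (cY x y).
Qed.

(* [p0] and [p1] collect the weights of the prefixes whose last letter agrees
   with the next chord sign, by defect; [F] and [G] are the weights after the
   next chord of the prefixes that then disagree with its sign. *)
Record staircase (F G p0 p1 : nat -> Prop) : Prop := Staircase {
  stair_F : convex F; stair_G : convex G; stair_p0 : convex p0; stair_p1 : convex p1;
  stair_P : convex (union p0 p1);
  stair_FG : convex (union F G);
  stair_FSG : convex (union F (shift G));
  stair_p0G : forall v, p0 v -> G v;
  stair_p1G : forall v, p1 v -> G v.+1;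
  stair_ex : exists v, p1 v;
  stair_near : near_sets (union p0 p1) (union F (shift G)) }.

Lemma eq_staircase F G p0 p1 F' G' p0' p1' :
  (forall v, F v <-> F' v) -> (forall v, G v <-> G' v) ->
  (forall v, p0 v <-> p0' v) -> (forall v, p1 v <-> p1' v) ->
  staircase F G p0 p1 -> staircase F' G' p0' p1'.
Proof.
move=> eF eG e0 e1 [cF cG c0 c1 cP cFG cFSG s0 s1 [w pw] [x [y [Px Cy l]]]].
have eS v : shift G v <-> shift G' v by split=> -[u /eG Gu ->]; exists u.
have eU X Y X' Y' v : (forall v, X v <-> X' v) -> (forall v, Y v <-> Y' v) ->
  union X Y v <-> union X' Y' v.
  by move=> eX eY; split=> -[/eX|/eY]; by [left|right].
split.
- exact: eq_convex cF.
- exact: eq_convex cG.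
- exact: eq_convex c0.
- exact: eq_convex c1.
- by apply: eq_convex cP => v; apply: eU.
- by apply: eq_convex cFG => v; apply: eU.
- by apply: eq_convex cFSG => v; apply: eU.
- by move=> v /e0/s0/eG.
- by move=> v /e1/s1/eG.
- by exists w; apply/e1.
- exists x, y; split=> //.
    exact/(eU _ _ _ _ _ e0 e1).
  exact/(eU _ _ _ _ _ eF eS).
Qed.

Section StaircaseSteps.
Variables F G p0 p1 : nat -> Prop.
Hypothesis st : staircase F G p0 p1.
Let P := union p0 p1.
Let C := union F (shift G).

Let near_C_P1 : near_sets C (shift P).
Proof.
have [w pw] := stair_ex st; exists w.+2, w.+1; split=> //; try (by lia).
  by right; exists w.+1 => //; apply: stair_p1G st _ pw.
by exists w => //; right.
Qed.

Let convex_C_P1 : convex (union C (shift P)).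
Proof.
apply: convex_union (stair_FSG st) (convex_shift (stair_P st)) _ => _ _.
exact: near_C_P1.
Qed.

(** Next sign equal to the present one. The face in between then has an unmatched exterior edge, so
    every agreeing prefix gets defect 1 and none has defect 0. *)
Lemma staircase_same : staircase C (shift P) (fun=> False) P.
Proof.
have [cF cG c0 c1 cP cFG cFSG s0 s1 [w pw] nr] := st; split=> //.
- exact: convex_shift.
- by apply: eq_convex cP => v; split=> [Pv|[]//]; right.
- apply: convex_union => //; first by do 2!apply: convex_shift.
  move=> _ _; exists w.+2, w.+2; split=> //; try (by lia).
    by right; exists w.+1 => //; apply: s1.
  by exists w.+1 => //; exists w => //; right.
- by move=> v Pv; exists v.
- by exists w; right.
- have [x [y [Px Cy l]]] := nr; exists x, y; split=> //; by [right|left].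
Qed.

(** Next sign different, with an unmatched exterior edge in between: the prefixes that disagreed now
    agree, and conversely. The union of [P] and [C] appears here, which is why [stair_near] is part
    of the invariant. *)
Lemma staircase_switch : staircase (shift P) C F G.
Proof.
have [cF cG c0 c1 cP cFG cFSG s0 s1 [w pw] nr] := st; split=> //.
- exact: convex_shift.
- by apply: eq_convex convex_C_P1 => v; split=> -[]; by [left|right].
- have: convex (shift (union P C)) by apply/convex_shift/convex_union.
  apply: eq_convex => v; split.
    by case=> u [Pu|Cu] ->; [left|right]; exists u.
  by case=> -[u Xu ->]; exists u => //; by [left|right].
- by move=> v Fv; left.
- by move=> v Gv; right; exists v.
- by exists w.+1; apply: s1.
- exists w.+1, w.+1; split=> //; try (by lia); first by right; apply: s1.
  by left; exists w => //; right.
Qed.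

(** Next sign different, all exterior edges in between matched: the defects 0 and 1 of the prefixes
    that now disagree become 1 and 2 instead of being merged into 1. *)
Lemma staircase_tight : staircase (shift p0) (union C (shift p1)) F G.
Proof.
have [cF cG c0 c1 cP cFG cFSG s0 s1 [w pw] nr] := st.
have cG' : convex (union C (shift p1)).
  apply: convex_union => //; first exact: convex_shift.
  move=> _ _; exists w.+2, w.+1; split=> //; try (by lia); last by exists w.
  by right; exists w.+1 => //; apply: s1.
split=> //.
- exact: convex_shift.
- apply: eq_convex convex_C_P1 => v; split.
    by case=> [Cv|[u [p0u|p1u] ->]]; [right; left|left; exists u|right; right; exists u].
  by case=> [[u p0u ->]|[Cv|[u p1u ->]]]; [right; exists u => //; left|left|right; exists u => //; right].
- apply: convex_union; [exact: convex_shift|exact: convex_shift|].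
  move=> _ [x p0x _]; exists x.+1, x.+2; split=> //; try (by lia); first by exists x.
  by exists x.+1 => //; left; right; exists x => //; apply: s0.
- by move=> v Fv; left; left.
- by move=> v Gv; left; right; exists v.
- by exists w.+1; apply: s1.
- exists w.+1, w.+2; split=> //; try (by lia); first by right; apply: s1.
  by right; exists w.+1 => //; right; exists w.
Qed.

End StaircaseSteps.

(* A word [z] gives one letter to each of the faces [0, ..., N]; the letters of
   the faces [k] and [k.+1] may differ only as [(a k, ~~ a k)], and then the
   chord [k] is matched. [nf k b] says that, when the face [k] has the letter
   [b], all its exterior edges are matched. *)
Section Words.
Variables (N : nat) (a : nat -> bool) (nf : nat -> bool -> bool).
Hypothesis nfP : forall k b, nf k b ->
  [/\ 0 < k, k < N, a k.-1 = b & a k = ~~ b].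

Definition valid (n : nat) (z : nat -> bool) : Prop :=
  forall k, k < n -> ~~ ((z k == ~~ a k) && (z k.+1 == a k)).

(* [cost_state z k = (v, d)]: hitting everything that closes before the face [k]
   costs [v], and [v + d] if moreover everything still open after the face [k]
   is hit. *)
Definition step_chord (k : nat) (x y : bool) (s : nat * nat) : nat * nat :=
  if x != y then (s.1 + s.2, 1)
  else if x == a k then (s.1, s.2.+1)
  else (s.1 + minn s.2 1, s.2.-1).

Definition step_face (k : nat) (y : bool) (s : nat * nat) : nat * nat :=
  if nf k y then s else (s.1, minn s.2 1).

Fixpoint cost_state (z : nat -> bool) (k : nat) : nat * nat :=
  if k is j.+1 then step_face j.+1 (z j.+1) (step_chord j (z j) (z j.+1) (cost_state z j))
  else (0, 1).

Definition cost (z : nat -> bool) : nat := (cost_state z N).1 + (cost_state z N).2.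

(** * Cost of hitting all differences with a fixed word *)

Section Hitting.
Variable z : nat -> bool.
Hypothesis zV : valid N z.

(** An anti-forcing set avoids the matching, so it can only use positions that carry an unmatched
    edge. *)
Definition admissible (n : nat) (occ : nat -> bool) : Prop :=
  (forall k, k <= n -> occ k.*2 -> ~~ nf k (z k)) /\
  (forall k, k < n -> occ k.*2.+1 -> z k = z k.+1).

(** [D] is the difference with another valid word. An unmatched edge where [face_sum D] holds
    belongs to the other matching, so deleting it excludes that matching. *)
Definition hitting (occ : nat -> bool) : Prop :=
  forall D : nat -> bool, valid N (fun k => z k (+) D k) ->
    (forall p, p <= N.*2 -> occ p -> ~~ face_sum D p) ->
    forall k, k <= N -> D k = false.

(* Some set of faces compatible with [z], not hit by [occ], contains the face
   [k] and no later face so far. *)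
Fixpoint alive (occ : nat -> bool) (k : nat) : bool :=
  ~~ occ k.*2 &&
  if k is j.+1 then
    alive occ j && (z j == z j.+1) ||
    ~~ ((z j == ~~ a j) && (z j.+1 == ~~ a j)) && ~~ occ j.*2.+1
  else true.

Definition closing (occ : nat -> bool) (k : nat) : bool :=
  [&& alive occ k, ~~ ((z k == a k) && (z k.+1 == a k)) & ~~ occ k.*2.+1].

Definition never_closing (occ : nat -> bool) (n : nat) : Prop :=
  forall k, k < n -> ~~ closing occ k.

(** Each clause of [alive] dictates a witness: prolong the previous one by the face [k.+1], or start
    afresh with that face alone. *)
Lemma aliveP occ k : k <= N -> alive occ k ->
  exists D : nat -> bool, [/\ D k, valid k (fun k => z k (+) D k) &
     forall p, p <= k.*2 -> occ p -> ~~ face_sum D p].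
Proof.
elim: k => [_ /=|k IH lekN].
  rewrite andbT => o0; exists xpredT; split=> // p.
  by rewrite leqn0 => /eqP ->; rewrite (negPf o0).
rewrite /= => /andP[ok1]; have vk := zV lekN.
case/orP=> [/andP[alk /eqP zk]|/andP[nL ock]].
  have [D [Dk DV DU]] := IH (ltnW lekN) alk.
  exists (fun j => if j == k.+1 then true else D j); split=> [|j|p].
  - by rewrite eqxx.
  - rewrite ltnS leq_eqVlt => /orP[/eqP->|ltjk].
      by rewrite eqxx Dk ltn_eqF // zk; case: (z _); case: (a _).
    by rewrite !ltn_eqF ?DV //; lia.
  - rewrite doubleS leq_eqVlt => /orP[/eqP->|]; first by rewrite -doubleS (negPf ok1).
    rewrite ltnS leq_eqVlt => /orP[/eqP->|].
      by rewrite face_sum_odd eqxx Dk ltn_eqF.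
    move=> lep op; rewrite (@eq_face_sum _ D) ?DU // => j lej.
    by rewrite ltn_eqF //; move: lep lej; clear; lia.
exists (fun j => j == k.+1); split=> [|j|p].
- by rewrite eqxx.
- rewrite ltnS leq_eqVlt => /orP[/eqP->|ltjk].
    by rewrite eqxx ltn_eqF //; move: vk nL; case: (z k) (z k.+1) (a k) => [] [] [].
  by rewrite !ltn_eqF ?addbF ?zV //; lia.
- rewrite doubleS leq_eqVlt => /orP[/eqP->|]; first by rewrite -doubleS (negPf ok1).
  rewrite ltnS leq_eqVlt => /orP[/eqP->|]; first by rewrite (negPf ock).
  move=> lep op; rewrite (@eq_face_sum _ (fun=> false)) ?face_sum0 // => j lej.
  by rewrite ltn_eqF //; move: lep lej; clear; lia.
Qed.

(** A set that could close after the face [k] is cut off there: this flips nothing beyond the chord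
    [k], so it remains unhit. *)
Lemma hitting_closing occ : hitting occ -> never_closing occ N /\ ~~ alive occ N.
Proof.
move=> H; split=> [k ltk|]; apply/negP; last first.
  case/(aliveP (leqnn N)) => D [DN DV DU].
  by have := H D DV DU N (leqnn N); rewrite DN.
case/and3P=> alk nR ock; have [D [Dk DV DU]] := aliveP (ltnW ltk) alk.
suff: (k <= k) && D k = false by rewrite leqnn Dk.
apply: (H (fun j => (j <= k) && D j)) (ltnW ltk).
  move=> j ltj; have [ltjk|] := ltnP j k; first by rewrite ltnW //= DV.
  have := zV ltj; rewrite leq_eqVlt => zj /orP[/eqP ejk|ltkj]; last first.
    by rewrite leqNgt ltkj !addbF.
  by subst j; rewrite leqnn Dk; move: zj nR; case: (z k) (z k.+1) (a k) => [] [] [].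
move=> p lep op; have [lepk|ltkp] := leqP p k.*2.
  rewrite (@eq_face_sum _ D) ?DU // => j lej.
  by have -> : j <= k by move: lepk lej; clear; lia.
have [ep|nep] := eqVneq p k.*2.+1; first by move: op; rewrite ep (negPf ock).
have ltk2 : k < p./2 by move: ltkp nep; clear; lia.
by rewrite /face_sum [p./2 <= k]leqNgt ltk2 [p./2 < k]ltnNge (ltnW ltk2) if_same.
Qed.

(** Every face of an unhit [D] is alive; as nothing closes, [D] also contains all later faces,
    including the last one, which is not alive. *)
Lemma closing_hitting occ : never_closing occ N -> ~~ alive occ N -> hitting occ.
Proof.
move=> nc alN D DV DU.
have Dal k : k <= N -> D k -> alive occ k.
  elim: k => [_ D0|k IH ltk Dk1] /=.
    by rewrite andbT; apply/negP=> /(DU 0 isT); rewrite /face_sum /= D0.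
  apply/andP; split.
    apply/negP=> /(DU k.+1.*2); rewrite face_sum_even Dk1 => H.
    by have := H _; rewrite leq_double => /(_ ltk).
  have [Dk|nDk] := boolP (D k).
    rewrite (IH (ltnW ltk)) //=; have := DV k ltk; rewrite Dk Dk1.
    have := zV ltk.
    by case: (z k) (z k.+1) (a k) => [] [] []; rewrite ?orbT.
  have -> : ~~ occ k.*2.+1.
    apply/negP=> /(DU k.*2.+1); rewrite face_sum_odd Dk1 (negPf nDk) => H.
    by have := H _; rewrite ltn_double => /(_ ltk).
  have := DV k ltk; rewrite Dk1 (negPf nDk) andbT.
  by case: (z k) (z k.+1) (a k) (alive occ k) => [] [] [] [].
have DS k : k < N -> D k -> D k.+1.
  move=> ltk Dk; apply: contraT => nDk1.
  have := nc k ltk; rewrite /closing Dal 1?ltnW //=.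
  have -> : ~~ occ k.*2.+1.
    apply/negP=> /(DU k.*2.+1); rewrite face_sum_odd Dk (negPf nDk1) => H.
    by have := H _; rewrite ltn_double => /(_ ltk).
  have := DV k ltk; rewrite Dk (negPf nDk1).
  by case: (z k) (z k.+1) (a k) => [] [] [].
move=> k lek; apply/negP=> Dk; case/negP: alN; apply: Dal => //.
have: forall m, k + m <= N -> D (k + m).
  by elim=> [|m IH]; rewrite ?addn0 // addnS => lt; apply: DS => //; apply/IH/ltnW.
by move/(_ (N - k)); rewrite subnKC //; apply.
Qed.

Definition weight (occ : nat -> bool) (n : nat) : nat := \sum_(0 <= p < n) occ p.

Lemma weight_face occ k :
  weight occ k.+1.*2.+1 = weight occ k.*2.+1 + occ k.*2.+1 + occ k.+1.*2.
Proof. by rewrite /weight doubleS !big_nat_recr. Qed.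

(** The automaton is optimal at each step: for every choice of letters, signs and occupied
    positions, either validity, admissibility, [nfP] or [never_closing] excludes it, or the bound
    follows from the previous one by arithmetic. *)
Lemma cost_lower occ k : k <= N -> admissible N occ -> never_closing occ k ->
  (cost_state z k).1 + (if alive occ k then 0 else (cost_state z k).2)
    <= weight occ k.*2.+1.
Proof.
move=> lekN [oce occ_o]; elim: k lekN => [_ _|k IH ltk nc].
  by rewrite /weight /= big_nat1 andbT add0n; case: (occ 0).
have {}IH := IH (ltnW ltk) (fun j ltj => nc j (leqW ltj)).
rewrite weight_face /=; have := nc k (leqnn _); rewrite /closing.
have := oce k.+1 ltk; have := occ_o k ltk; have := zV ltk; have := @nfP k.+1 (z k.+1).
rewrite /step_chord /step_face.
move: IH; case: (cost_state z k) => v d /=; move: (weight _ _) => t.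
move: (nf _ _) (alive occ k) (occ _.+1) (occ _.*2) => [] [] [] [].
all: case: (z k) (z k.+1) (a k) (a k.+1) => [] [] [] [] //=; clear.
all: try by move=> ? ? _ /(_ isT).
all: try by move=> ? ? _ _ /(_ isT).
all: try by move=> ? /(_ isT) [].
all: lia.
Qed.

Definition reachable (k : nat) (al : bool) (t : nat) : Prop :=
  exists occ, [/\ admissible k occ, never_closing occ k, alive occ k = al
                & weight occ k.*2.+1 = t].

Lemma reachable0 e : reachable 0 (~~ e) e.
Proof.
exists (fun p => (p == 0) && e); split=> //; last by rewrite /weight big_nat1.
  by split=> // [][] // _ _; apply/negP=> /nfP[].
by rewrite /= andbT.
Qed.

Lemma eq_alive occ occ' k : (forall p, p <= k.*2 -> occ p = occ' p) ->
  alive occ k = alive occ' k.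
Proof.
elim: k => [|k IH] E /=; first by rewrite E.
have -> : alive occ k = alive occ' k.
  by apply: IH => p lep; apply/E/(leq_trans lep); rewrite leq_double.
by rewrite !E // doubleS.
Qed.

Lemma reachableS k al t (c e : bool) : k < N -> reachable k al t ->
  (e -> ~~ nf k.+1 (z k.+1)) -> (c -> z k = z k.+1) ->
  ~~ [&& al, ~~ ((z k == a k) && (z k.+1 == a k)) & ~~ c] ->
  reachable k.+1
    (~~ e && (al && (z k == z k.+1) || ~~ ((z k == ~~ a k) && (z k.+1 == ~~ a k)) && ~~ c))
    (t + c + e).
Proof.
move=> ltk [occ [[oce oco] nc alk wt]] He Hc ncl.
pose occ' p := if p == k.*2.+1 then c else if p == k.+1.*2 then e else occ p.
have occ'E p : p <= k.*2 -> occ' p = occ p.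
  by move=> lep; rewrite /occ' !ltn_eqF ?doubleS //; apply: (leq_trans lep).
have occ'c : occ' k.*2.+1 = c by rewrite /occ' eqxx.
have occ'e : occ' k.+1.*2 = e by rewrite /occ' eqxx doubleS gtn_eqF.
have alE j : j <= k -> alive occ' j = alive occ j.
  by move=> lej; apply: eq_alive => p lep; rewrite occ'E //; apply/(leq_trans lep); rewrite leq_double.
exists occ'; split.
- split=> [j|j]; rewrite ?ltnS leq_eqVlt => /orP[/eqP->|ltj].
  + by rewrite occ'e.
  + by rewrite occ'E ?leq_double //; apply: oce.
  + by rewrite occ'c.
  + by rewrite occ'E ?ltn_double //; apply: oco.
- move=> j; rewrite ltnS leq_eqVlt => /orP[/eqP->|ltj].
    by rewrite /closing occ'c alE // alk.
  by rewrite /closing alE 1?ltnW // occ'E ?ltn_double //; apply: nc.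
- by rewrite /= occ'e occ'c alE // alk.
- rewrite weight_face occ'c occ'e -wt; congr (_ + _ + _).
  by apply: eq_big_nat => p /andP[_ lep]; rewrite occ'E.
Qed.

Lemma cost_upper k : k <= N ->
  reachable k false ((cost_state z k).1 + (cost_state z k).2) /\
  exists al, reachable k al (cost_state z k).1.
Proof.
elim: k => [_|k IH ltk].
  by split; [apply: (reachable0 true)|exists true; apply: (reachable0 false)].
have [RB [al RA]] := IH (ltnW ltk).
have goA (c e al' : bool) t t' : reachable k al' t ->
    (e -> ~~ nf k.+1 (z k.+1)) -> (c -> z k = z k.+1) ->
    ~~ [&& al', ~~ ((z k == a k) && (z k.+1 == a k)) & ~~ c] ->
    t + c + e = t' -> exists al, reachable k.+1 al t'.
  by move=> R He Hc Hn <-; eexists; apply: reachableS R He Hc Hn.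
have goB (c e al' : bool) t t' : reachable k al' t ->
    (e -> ~~ nf k.+1 (z k.+1)) -> (c -> z k = z k.+1) ->
    ~~ [&& al', ~~ ((z k == a k) && (z k.+1 == a k)) & ~~ c] ->
    ~~ e && (al' && (z k == z k.+1) ||
       ~~ ((z k == ~~ a k) && (z k.+1 == ~~ a k)) && ~~ c) = false ->
    t + c + e = t' -> reachable k.+1 false t'.
  by move=> R He Hc Hn Hal <-; rewrite -Hal; apply: reachableS R He Hc Hn.
rewrite /= /step_chord /step_face.
case: (cost_state z k) RA RB => v d /= RA RB.
have [zk|zk] := eqVneq (z k) (z k.+1); last first.
  have [zk0 zk1] : z k = a k /\ z k.+1 = ~~ a k.
    by have := zV ltk; move: zk; case: (z k) (z k.+1) (a k) => [] [] [].
  have nnf : ~~ nf k.+1 (z k.+1).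
    by apply/negP=> /nfP[_ _ /=]; rewrite zk1; case: (a k).
  rewrite (negPf nnf) /=; split.
    by apply: (goB false true _ _ _ RB); rewrite ?addn0.
  by apply: (goA false false _ _ _ RB); rewrite ?addn0.
(* Both letters opposite to the sign: nothing can start at the chord, but an alive set could close,
   so either nothing is alive or the chord is occupied. *)
rewrite -zk in goA goB *; have [zka|zka] := eqVneq (z k) (a k); last first.
  have zna : z k = ~~ a k by move: zka; case: (z k) (a k) => [] [].
  have nnf : ~~ nf k.+1 (z k).
    by apply/negP=> /nfP[_ _ /= E]; rewrite E eqxx in zka.
  rewrite (negPf nnf) /=; case: d RB => [|d] RB /=.
    split.
      by apply: (goB false false _ _ _ RB); rewrite ?zna ?eqxx //; lia.
    by apply: (goA false false _ _ _ RB) => //; lia.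
  split; last by apply: (goA true false _ _ _ RA); rewrite ?andbF //; lia.
  case: d RB => [|d] RB.
    by apply: (goB false false _ _ _ RB); rewrite ?zna ?eqxx //; lia.
  by apply: (goB true true _ _ _ RA); rewrite ?andbF //; lia.
(* Both letters equal to the sign: nothing can close. To leave nothing alive, occupy the exterior of
   the face [k.+1]; if all of it is matched, start from a dead prefix and occupy the chord. *)
rewrite zka eqxx /= in goA goB *.
have RA' : exists al, reachable k.+1 al v.
  by apply: (goA false false _ _ _ RA); rewrite ?andbF //; lia.
case: ifP => nfk /=; split=> //.
  by apply: (goB true false _ _ _ RB); rewrite ?andbF //; lia.
by apply: (goB false true _ _ _ RA); rewrite ?nfk ?andbF //; lia.
Qed.

Lemma cost_hitting occ : admissible N occ -> hitting occ -> cost z <= weight occ N.*2.+1.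
Proof.
move=> adm /hitting_closing[nc /negPf alN].
by have := cost_lower (leqnn N) adm nc; rewrite alN.
Qed.

Lemma cost_attained :
  exists occ, [/\ admissible N occ, hitting occ & weight occ N.*2.+1 = cost z].
Proof.
have [[occ [adm nc alN w]] _] := cost_upper (leqnn N).
by exists occ; split=> //; apply: closing_hitting; rewrite ?alN.
Qed.

End Hitting.

(** * Weights attained by all words together *)

Definition prefix_state (k : nat) (x : bool) (s : nat * nat) : Prop :=
  exists z, [/\ valid k z, z k = x & cost_state z k = s].

Lemma eq_cost_state z z' k : (forall j, j <= k -> z j = z' j) ->
  cost_state z k = cost_state z' k.
Proof.
elim: k => //= k IH E; rewrite IH ?E // => j lej.
by rewrite E // ltnW.
Qed.

Lemma prefix_stateS k y s' : prefix_state k.+1 y s' <->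
  exists x s, [/\ prefix_state k x s, ~~ ((x == ~~ a k) && (y == a k))
    & s' = step_face k.+1 y (step_chord k x y s)].
Proof.
split=> [[z [zV <- <-]]|[x [s [[z [zV <- <-]] xy ->]]]].
  exists (z k), (cost_state z k); split=> //; last exact: zV.
  by exists z; split=> // j ltj; apply/zV/ltnW.
pose z' j := if j == k.+1 then y else z j.
have z'E j : j <= k -> z' j = z j by move=> lej; rewrite /z' ltn_eqF.
have z'k : z' k.+1 = y by rewrite /z' eqxx.
exists z'; split=> //.
  move=> j; rewrite ltnS leq_eqVlt => /orP[/eqP->|ltj].
    by rewrite z'k z'E.
  by rewrite !z'E ?(ltnW ltj) // zV.
by rewrite /= z'k (z'E k) // (eq_cost_state z'E).
Qed.

Lemma prefix_state_same k v d : prefix_state k.+1 (a k) (v, d) <->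
  exists2 e, prefix_state k (a k) (v, e) & d = if nf k.+1 (a k) then e.+1 else 1.
Proof.
rewrite prefix_stateS; split=> [[x [[u e] [ps ok]]]|[e ps ->]].
  have xa : x = a k by move: ok; rewrite eqxx andbT; case: (x) (a k) => [] [].
  rewrite /step_chord xa !eqxx /= /step_face in ps *.
  by case: ifP => _ [-> ->]; exists e => //; lia.
exists (a k), (v, e); split=> //; first by case: (a k).
rewrite /step_chord !eqxx /step_face /=; case: ifP => // _; congr (_, _); lia.
Qed.

Lemma prefix_state_flip k v d : prefix_state k.+1 (~~ a k) (v, d) <->
  (exists e u, [/\ prefix_state k (a k) (u, e), v = u + e & d = 1]) \/
  (exists e u, [/\ prefix_state k (~~ a k) (u, e), v = u + minn e 1 & d = minn e.-1 1]).
Proof.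
have nnf : nf k.+1 (~~ a k) = false by apply/negP=> /nfP[_ _ /=]; case: (a k).
have naa : (~~ a k == a k) = false by case: (a k).
have ana : (a k == ~~ a k) = false by case: (a k).
rewrite prefix_stateS /step_face nnf /step_chord; split.
  case=> x [[u e] [ps _]]; have [xa|xa] := eqVneq x (~~ a k).
    by subst x; rewrite naa => -[-> ->]; right; exists e, u.
  have {}xa : x = a k by move: xa; case: (x) (a k) => [] [].
  by subst x; case=> -> ->; left; exists e, u.
case=> [[e [u [ps -> ->]]]|[e [u [ps -> ->]]]].
  by exists (a k), (u, e); rewrite ana.
by exists (~~ a k), (u, e); rewrite eqxx naa.
Qed.

(** The weights with defect 0 and letter [~~ a k] once the chord [k] is passed: a defect of 1 is
    paid at the chord. *)
Definition closed_weights k : nat -> Prop :=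
  union (fun v => prefix_state k (~~ a k) (v, 0))
        (shift (fun v => prefix_state k (~~ a k) (v, 1))).

(** The same with defect 1: a prefix that changes letter pays its whole defect and opens a new one,
    and a defect of 2 is lowered to 1. *)
Definition open_weights k : nat -> Prop :=
  union (fun v => prefix_state k (a k) (v, 0))
        (union (shift (fun v => prefix_state k (a k) (v, 1)))
               (shift (fun v => prefix_state k (~~ a k) (v, 2)))).

(** Defect 2 arises only at a face whose exterior edges are all matched, and by [nfP] the letter of
    such a face disagrees with the next sign. *)
Definition prefix_invariant k : Prop :=
  [/\ forall v d, prefix_state k (a k) (v, d) -> d <= 1,
      forall v d, prefix_state k (~~ a k) (v, d) -> d <= 2 &
      staircase (closed_weights k) (open_weights k)
        (fun v => prefix_state k (a k) (v, 0)) (fun v => prefix_state k (a k) (v, 1))].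

Lemma prefix_state0 x s : prefix_state 0 x s <-> s = (0, 1).
Proof.
split=> [[z [_ _ <-]] //|->].
by exists (fun=> x); split.
Qed.

Lemma prefix_invariantP k : k <= N -> prefix_invariant k.
Proof.
elim: k => [_|k IH ltk].
  split=> [v d|v d|].
  - by case/prefix_state0=> _ ->.
  - by case/prefix_state0=> _ ->.
  (* Both letters start in the state [(0, 1)], so the four sets are {1}, {1}, the empty set and
     {0}. *)
  have E1 v : (1 = v :> nat) <-> closed_weights 0 v.
    split=> [<-|[/prefix_state0//|[u /prefix_state0[-> ] ->//]]].
    by right; exists 0 => //; apply/prefix_state0.
  have E2 v : (1 = v :> nat) <-> open_weights 0 v.
    split=> [<-|[/prefix_state0//|[|][u /prefix_state0]//[-> ->]//]].
    by right; left; exists 0 => //; apply/prefix_state0.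
  have E3 v : False <-> prefix_state 0 (a 0) (v, 0) by split=> // /prefix_state0.
  have E4 v : (0 = v :> nat) <-> prefix_state 0 (a 0) (v, 1).
    by split=> [<-|/prefix_state0[->]//]; apply/prefix_state0.
  apply: (eq_staircase E1 E2 E3 E4).
  split=> //; try by move=> ? ? ? <- <-; lia.
  - by move=> x y t [//|<-] [//|<-] l; right; lia.
  - by move=> x y t [] <- [] <- l; left; lia.
  - move=> x y t [<-|[_ <- ->]] [<-|[_ <- ->]] l; try by left; lia.
    + by case: t l => [|[|[|]]] // _; [left|right; exists 1].
    + by right; exists 1 => //; lia.
  - by move=> v <-.
  - by exists 0.
  - by exists 0, 1; split=> //; [right|left].
have [pN mN st] := IH (ltnW ltk).
have F0 v : prefix_state k.+1 (~~ a k) (v, 0) <-> closed_weights k v.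
  split=> [/prefix_state_flip[[e [u [_ _ //]]]|[e [u [ps -> d0]]]]|].
    have : e <= 1 by lia.
    case: e ps {d0} => [|[|//]] ps _; first by left; rewrite addn0.
    by right; exists u => //; rewrite addn1.
  case=> [ps|[u ps ->]]; apply/prefix_state_flip; right.
    by exists 0, v; split=> //; rewrite addn0.
  by exists 1, u; split=> //; rewrite addn1.
have G1 v : prefix_state k.+1 (~~ a k) (v, 1) <-> open_weights k v.
  split=> [/prefix_state_flip[[e [u [ps -> _]]]|[e [u [ps -> d1]]]]|].
  - case: e ps => [|[|e]] ps; first by left; rewrite addn0.
      by right; left; exists u => //; rewrite addn1.
    by have := pN _ _ ps.
  - have := mN _ _ ps; have e2 : 2 <= e by lia.
    case: e ps e2 {d1} => [|[|[|//]]] // ps _ _.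
    by right; right; exists u => //; rewrite addn1.
  case=> [ps|[[u ps ->]|[u ps ->]]]; apply/prefix_state_flip.
  - by left; exists 0, v; split=> //; rewrite addn0.
  - by left; exists 1, u; split=> //; rewrite addn1.
  - by right; exists 2, u; split=> //; rewrite addn1.
have fB v d : prefix_state k.+1 (~~ a k) (v, d) -> d <= 1.
  by case/prefix_state_flip=> -[e [u [_ _ ->]]] //; lia.
have [ea|] := eqVneq (a k.+1) (a k).
  have nnf : nf k.+1 (a k) = false by apply/negP=> /nfP[_ _ _]; rewrite ea; case: (a k).
  have P1 v d : prefix_state k.+1 (a k) (v, d) <->
      d = 1 /\ union (fun v => prefix_state k (a k) (v, 0))
                     (fun v => prefix_state k (a k) (v, 1)) v.
    rewrite prefix_state_same nnf; split=> [[e ps ->]|[-> []]]; last 2 first.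
    - by exists 0.
    - by exists 1.
    by split=> //; have := pN _ _ ps; case: e ps => [|[|//]] ps _; [left|right].
  split; rewrite ?ea.
  - by move=> v d /P1[->].
  - by move=> v d /fB/leq_trans->.
  apply: eq_staircase (staircase_same st) => v.
  - rewrite /closed_weights ea; split.
      by case=> [/F0|[u /G1 ps ->]]; [left|right; exists u].
    by case=> [/F0|[u /G1 ps ->]]; [left|right; exists u].
  - rewrite /open_weights ea; split.
      by case=> u Pu ->; right; left; exists u => //; apply/P1.
    case=> [/P1[]//|[[u /P1[_ Pu] ->]|[u /fB]//]].
    by exists u.
  - by rewrite P1; split=> // -[].
  - by rewrite P1; split=> // -[].
move=> nea; have ea : a k.+1 = ~~ a k by move: nea; case: (a k) (a k.+1) => [] [].
case nfk: (nf k.+1 (a k)).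
  have P1 v d : prefix_state k.+1 (a k) (v, d) <->
      exists2 e, prefix_state k (a k) (v, e) & d = e.+1.
    by rewrite prefix_state_same nfk.
  split; rewrite ?ea ?negbK.
  - exact: fB.
  - by move=> v d /P1[e /pN le1 ->].
  apply: eq_staircase (staircase_tight st) => v.
  - rewrite /closed_weights ea negbK; split.
      by case=> u pu ->; right; exists u => //; apply/P1; exists 0.
    case=> [/P1[]//|[u /P1[e pe [e0]] ->]]; exists u => //.
    by rewrite e0.
  - rewrite /open_weights ea negbK; split.
      case=> [[/F0|[u /G1 ps ->]]|[u pu ->]]; [by left|by right; left; exists u|].
      by right; right; exists u => //; apply/P1; exists 1.
    case=> [/F0|[[u /G1 pu ->]|[u /P1[e pe [e1]] ->]]].
    + by left; left.
    + by left; right; exists u.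
    + by right; exists u => //; rewrite e1.
  - exact: iff_sym (F0 v).
  - exact: iff_sym (G1 v).
have P1 v d : prefix_state k.+1 (a k) (v, d) <->
    d = 1 /\ union (fun v => prefix_state k (a k) (v, 0))
                   (fun v => prefix_state k (a k) (v, 1)) v.
  rewrite prefix_state_same nfk; split=> [[e ps ->]|[-> []]]; last 2 first.
  - by exists 0.
  - by exists 1.
  by split=> //; have := pN _ _ ps; case: e ps => [|[|//]] ps _; [left|right].
split; rewrite ?ea ?negbK.
- exact: fB.
- by move=> v d /P1[->].
apply: eq_staircase (staircase_switch st) => v.
- rewrite /closed_weights ea negbK; split.
    by case=> u pu ->; right; exists u => //; apply/P1.
  by case=> [/P1[]//|[u /P1[_ pu] ->]]; exists u.
- rewrite /open_weights ea negbK; split.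
    by case=> [/F0|[u /G1 ps ->]]; [left|right; left; exists u].
  case=> [/F0|[[u /G1 pu ->]|[u /P1[//]]]]; first by left.
  by right; exists u.
- exact: iff_sym (F0 v).
- exact: iff_sym (G1 v).
Qed.

Lemma prefix_state_last x v d : prefix_state N x (v, d) -> d <= 1.
Proof.
case=> z [_ _]; case EN: N => [|n] /=; first by case=> _ <-.
rewrite /step_face; case: ifP => [/nfP[_]|_].
  by rewrite -EN ltnn.
by case=> _ <-; lia.
Qed.

(** There is no chord [N], but [a N] still splits the final states by their letter, and both weight
    sets then add to the weight its final defect, at most 1, which gives the cost. *)
Lemma convex_cost : convex (fun n => exists2 z, valid N z & n = cost z).
Proof.
have [_ _ st] := prefix_invariantP (leqnn N).
apply: eq_convex (stair_FG st) => v; split.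
  have mk x u d t : prefix_state N x (u, d) -> t = u + d -> exists2 z, valid N z & t = cost z.
    by case=> z [zV _ E] ->; exists z => //; rewrite /cost E.
  case=> [[ps|[u ps ->]]|[ps|[[u ps ->]|[u /prefix_state_last//]]]].
  - by apply: (mk _ _ _ _ ps); rewrite addn0.
  - by apply: (mk _ _ _ _ ps); rewrite addn1.
  - by apply: (mk _ _ _ _ ps); rewrite addn0.
  - by apply: (mk _ _ _ _ ps); rewrite addn1.
case=> z zV ->; rewrite /cost; case E: (cost_state z N) => [u d] /=.
have ps x : z N = x -> prefix_state N x (u, d) by exists z.
have := prefix_state_last (ps _ erefl).
have [zN|zN] := eqVneq (z N) (a N).
  have {}ps := ps _ zN; case: d {E} ps => [|[|//]] ps _; right; [left|right; left].
    by rewrite addn0.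
  by exists u; rewrite ?addn1.
have {}zN : z N = ~~ a N by move: zN; case: (z N) (a N) => [] [].
have {}ps := ps _ zN; case: d {E} ps => [|[|//]] ps _; left; [left|right].
  by rewrite addn0.
by exists u; rewrite ?addn1.
Qed.

End Words.

(** * Perfect matchings of a chain *)

Lemma face_sumD h h' p :
  face_sum (fun k => h k (+) h' k) p = face_sum h p (+) face_sum h' p.
Proof. by rewrite /face_sum; case: odd; rewrite // addbACA. Qed.

Lemma face_sum_prefix k p : face_sum (fun j => j <= k) p =
  (p == k.*2.+1) (+) (~~ odd p && (p < k.*2.+1)).
Proof.
rewrite /face_sum; case: ifP => odp /=; apply/idP/idP; lia.
Qed.

Lemma face_sum_truncate h k p : face_sum (fun j => (j <= k) && h j) p =
  ((p < k.*2.+1) && face_sum h p) (+) ((p == k.*2.+1) && h k).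
Proof.
rewrite /face_sum; case: ifP => odp.
  have [E|np] := eqVneq p k.*2.+1.
    by rewrite E ltnn /= uphalf_double leqnn ltnn /= addbF.
  rewrite addbF; have [ltp|ltp] := ltnP p k.*2.+1.
    have l1 : p./2 <= k by lia.
    have l2 : p./2 < k by lia.
    by rewrite l1 l2.
  have l1 : (p./2 <= k) = false by lia.
  have l2 : (p./2 < k) = false by lia.
  by rewrite l1 l2.
have l1 : (p == k.*2.+1) = false by lia.
have l2 : (p./2 <= k) = (p < k.*2.+1) by lia.
by rewrite l1 l2 addbF.
Qed.

Lemma face_sum_single k p : face_sum (fun j => j == k) p =
  [|| p == k.*2, p == k.*2.+1 | p.+1 == k.*2].
Proof. by rewrite /face_sum; case: ifP => odp /=; apply/idP/idP; lia. Qed.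

(** * Degree parities of edge sets *)

Section Parity.
Variable G : sgraph.
Implicit Types (v : G) (e f : {set G}) (P Q : {set G} -> bool).

Lemma edgesP e : reflect (exists x y, adj x y /\ e = [set x; y]) (e \in edges G).
Proof.
apply: (iffP imsetP) => [[[x y] xy ->]|[x [y [xy ->]]]]; first by exists x, y; rewrite inE in xy.
by exists (x, y); rewrite ?inE.
Qed.

Lemma card_edge e : e \in edges G -> #|e| = 2.
Proof.
case/edgesP=> x [y [xy ->]]; rewrite cards2; case: eqP => // E.
by move: xy; rewrite E adj_irrefl.
Qed.

Definition degree_parity v P : bool := \big[addb/false]_(e in edges G | v \in e) P e.

Lemma eq_degree_parity v P Q : (forall e, e \in edges G -> v \in e -> P e = Q e) ->
  degree_parity v P = degree_parity v Q.
Proof. by move=> E; apply: eq_bigr => e /andP[eE ve]; apply: E. Qed.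

Lemma degree_parityD v P Q :
  degree_parity v (fun e => P e (+) Q e) = degree_parity v P (+) degree_parity v Q.
Proof. exact: big_split. Qed.

Lemma degree_parity0 v P : (forall e, e \in edges G -> v \in e -> P e = false) ->
  degree_parity v P = false.
Proof. by move=> E; apply: big1 => e /andP[eE ve]; apply: E. Qed.

Lemma degree_parity1 v P e : e \in edges G -> v \in e ->
  (forall f, f \in edges G -> v \in f -> f != e -> P f = false) ->
  degree_parity v P = P e.
Proof.
move=> eE ve E; rewrite /degree_parity (bigD1 e) ?eE //= big1 ?addbF //.
by move=> f /andP[/andP[fE vf] nfe]; apply: E.
Qed.

Lemma degree_parity2 v P e e' : e \in edges G -> v \in e ->
  e' \in edges G -> v \in e' -> e' != e ->
  (forall f, f \in edges G -> v \in f -> f != e -> f != e' -> P f = false) ->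
  degree_parity v P = P e (+) P e'.
Proof.
move=> eE ve e'E ve' ne E; rewrite /degree_parity (bigD1 e) ?eE //=.
rewrite (bigD1 e') ?e'E ?ve' //= big1 ?addbF //.
by move=> f /andP[/andP[/andP[fE vf] nfe] nfe']; apply: E.
Qed.

Lemma degree_parity_ex v P : degree_parity v P ->
  exists e, [/\ e \in edges G, v \in e & P e].
Proof.
move=> dP; case: (pickP [pred e | [&& e \in edges G, v \in e & P e]]) => [e /and3P[]|no].
  by exists e.
move: dP; rewrite degree_parity0 // => e eE ve.
by have := no e; rewrite /= eE ve.
Qed.

Lemma degree_parity_other v P e : degree_parity v P = false ->
  e \in edges G -> v \in e -> P e ->
  exists f, [/\ f \in edges G, v \in f, P f & f != e].
Proof.
move=> d0 eE ve Pe.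
case: (pickP [pred f | [&& f \in edges G, v \in f, P f & f != e]]) => [f /and4P[]|no].
  by exists f.
move: d0; rewrite (degree_parity1 eE ve) ?Pe // => f fE vf nfe.
by have := no f; rewrite /= fE vf nfe andbT.
Qed.

Lemma pm_sub (M : {set {set G}}) : perfect_matching (edges G) M -> M \subset edges G.
Proof. by case/andP. Qed.

Lemma pm_unique (M : {set {set G}}) v e f : perfect_matching (edges G) M ->
  e \in M -> f \in M -> v \in e -> v \in f -> e = f.
Proof.
case/andP=> _ /forallP/(_ v)/cards1P[g E] eM fM ve vf.
have : e \in [set e in M | v \in e] by rewrite inE eM.
have : f \in [set e in M | v \in e] by rewrite inE fM.
by rewrite E !inE => /eqP-> /eqP.
Qed.

Lemma pm_degree_parity (M : {set {set G}}) v : perfect_matching (edges G) M ->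
  degree_parity v (fun e => e \in M).
Proof.
move=> pM; have /andP[sM /forallP/(_ v)/cards1P[g E]] := pM.
have := set11 g; rewrite -E inE => /andP[gM vg].
rewrite (degree_parity1 (subsetP sM _ gM) vg) // => f fE vf; apply: contraNF => fM.
exact/eqP/(pm_unique pM fM gM vf vg).
Qed.

End Parity.

(* Edges are placed along the chain: position [k.*2] is the exterior boundary
   of the [k]-th face, position [k.*2.+1] the chord shared by the faces [k] and
   [k.+1]; [nxt] runs along the exterior Hamilton cycle. *)
Record chain_layout (G : sgraph) (N : nat) (pos : {set G} -> nat) (nxt : G -> G)
    (col : G -> bool) : Prop := ChainLayout {
  layout_inhabited : 0 < #|G|;
  pos_max : forall e, e \in edges G -> pos e <= N.*2;
  chord_ex : forall k, k < N -> exists2 e, e \in edges G & pos e = k.*2.+1;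
  chord_unique : forall e f, e \in edges G -> f \in edges G ->
    odd (pos e) -> pos e = pos f -> e = f;
  face_boundaries_generate : forall g : {set G} -> bool,
    (forall v, degree_parity v g = false) ->
    exists h : nat -> bool, forall e, e \in edges G -> g e = face_sum h (pos e);
  face_boundary_even : forall h v, degree_parity v (fun e => face_sum h (pos e)) = false;
  nxt_inj : injective nxt;
  nxt_nxt : forall v, nxt (nxt v) != v;
  nxt_edge : forall v, [set v; nxt v] \in edges G;
  nxt_exterior : forall v, ~~ odd (pos [set v; nxt v]);
  exterior_nxt : forall e, e \in edges G -> ~~ odd (pos e) -> exists v, e = [set v; nxt v];
  proper_col : forall x y : G, adj x y -> col x != col y }.

Section Layout.
Variables (G : sgraph) (N : nat) (pos : {set G} -> nat) (nxt : G -> G) (col : G -> bool).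
Hypothesis lay : chain_layout N pos nxt col.
Implicit Types (v w : G) (e f : {set G}) (z : nat -> bool).

Let nxtI := nxt_inj lay.
Let prv := invF nxtI.
Let out v := [set v; nxt v].

Let nxt_prv v : nxt (prv v) = v. Proof. exact: f_invF. Qed.

Let out_inj : injective out.
Proof.
move=> v w E; have := set21 v (nxt v); have := set22 v (nxt v).
rewrite -!/(out v) E !inE => /orP[/eqP vw|/eqP/nxtI //] /orP[/eqP //|/eqP wv].
by have := nxt_nxt lay w; rewrite -wv vw eqxx.
Qed.

Let outE v : out v \in edges G. Proof. exact: nxt_edge lay v. Qed.

Let col_nxt v : col (nxt v) = ~~ col v.
Proof.
case/edgesP: (outE v) => x [y [xy E]].
have : v \in [set x; y] by rewrite -E set21.
have : nxt v \in [set x; y] by rewrite -E set22.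
have nvv : nxt v != v.
  by apply/eqP=> e1; have := card_edge (outE v); rewrite /out e1 setUid cards1.
have := proper_col lay xy.
by rewrite !inE => cxy /orP[]/eqP e1 /orP[]/eqP e2; move: nvv cxy; rewrite e1 e2 ?eqxx //;
   case: (col x) (col y) => [] [].
Qed.

Let exterior_sum v (P : {set G} -> bool) : (forall e, e \in edges G -> P e -> ~~ odd (pos e)) ->
  degree_parity v P = P (out v) (+) P (out (prv v)).
Proof.
move=> Pe; apply: degree_parity2 => //.
- by rewrite set21.
- by rewrite !inE nxt_prv eqxx orbT.
- apply/eqP=> /out_inj E; have := nxt_prv v; rewrite E => nv.
  by have := nxt_nxt lay v; rewrite !nv eqxx.
move=> f fE vf n1 n2; apply/negP=> /(Pe _ fE)/(exterior_nxt lay fE)[w fw].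
move: vf n1 n2; rewrite fw !inE => /orP[]/eqP ->; first by rewrite eqxx.
by move=> _; rewrite /prv invF_f eqxx.
Qed.

(** Every second edge of the exterior Hamilton cycle, selected by the colour of its initial
    vertex. *)
Definition base_matching e : bool :=
  ~~ odd (pos e) && [exists v, col v && (e == out v)].

Let base_out v : base_matching (out v) = col v.
Proof.
rewrite /base_matching (nxt_exterior lay); apply/existsP/idP => [[w /andP[cw /eqP/out_inj ->]]|cv] //.
by exists v; rewrite cv eqxx.
Qed.

Let base_degree v : degree_parity v base_matching.
Proof.
rewrite exterior_sum => [|e _ /andP[]//].
by rewrite !base_out -{1}[v]nxt_prv col_nxt; case: col.
Qed.

Definition join z : {set {set G}} :=
  [set e in edges G | base_matching e (+) face_sum z (pos e)].

Lemma join_degree z v : degree_parity v (fun e => e \in join z).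
Proof.
rewrite (@eq_degree_parity _ _ _ (fun e => base_matching e (+) face_sum z (pos e))).
  by rewrite degree_parityD base_degree (face_boundary_even lay).
by move=> e eE _; rewrite inE eE.
Qed.

(** The difference with the base matching has even degrees, so it is a sum of face boundaries. *)
Lemma pm_join M : perfect_matching (edges G) M -> exists z, M = join z.
Proof.
move=> pM; have [|h hP] := @face_boundaries_generate _ _ _ _ _ lay
    (fun e => base_matching e (+) (e \in M)).
  by move=> v; rewrite degree_parityD base_degree pm_degree_parity.
exists h; apply/setP=> e; rewrite inE; case eE: (e \in edges G) => /=.
  by rewrite -hP // addbA addbb.
by apply: contraFF eE; apply/subsetP/pm_sub.
Qed.

Definition chord k : {set G} := odflt set0 [pick e in edges G | pos e == k.*2.+1].

Lemma chordP k : k < N -> chord k \in edges G /\ pos (chord k) = k.*2.+1.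
Proof.
move=> ltk; rewrite /chord; case: pickP => [e /andP[eE /eqP pe]|no] //=.
by have [e eE pe] := chord_ex lay ltk; have := no e; rewrite /= eE pe eqxx.
Qed.

Lemma chordE k e : k < N -> e \in edges G -> pos e = k.*2.+1 -> e = chord k.
Proof.
move=> ltk eE pe; have [cE pc] := chordP ltk.
by apply: (chord_unique lay) => //; rewrite ?pc // pe /= odd_double.
Qed.

Let chord_sum k v (P : {set G} -> bool) : k < N ->
  degree_parity v (fun e => (pos e == k.*2.+1) && P e) = (v \in chord k) && P (chord k).
Proof.
move=> ltk; have [cE pc] := chordP ltk.
have [vc|nvc] := boolP (v \in chord k); last first.
  apply: degree_parity0 => e eE ve; case: eqP => //= pe.
  by move: nvc; rewrite -(chordE ltk eE pe) ve.
rewrite (degree_parity1 cE vc) ?pc ?eqxx // => f fE vf nf.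
by apply: contraNF nf => /andP[/eqP pf _]; apply/eqP/chordE.
Qed.

Let left k v := pos (out v) < k.*2.+1.

(** The boundary of the faces up to [k] is even and consists of the chord and the exterior edges on
    its left, so the exterior cycle changes sides exactly at the ends of the chord. *)
Let left_sum k v : k < N -> left k v (+) left k (prv v) = (v \in chord k).
Proof.
move=> ltk; have := face_boundary_even lay (fun j => j <= k) v.
rewrite (@eq_degree_parity _ _ _ (fun e => ((pos e == k.*2.+1) && true) (+)
   (~~ odd (pos e) && (pos e < k.*2.+1)))); last first.
  by move=> e _ _; rewrite face_sum_prefix andbT.
rewrite degree_parityD chord_sum // andbT exterior_sum; last by move=> e _ /andP[].
by rewrite !(nxt_exterior lay) /= -!/(left _ _); case: (_ \in _) (left _ _) (left _ _) => [] [] [].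
Qed.

Definition base_left k v : bool :=
  degree_parity v (fun e => base_matching e && (pos e < k.*2.+1)).

Let base_leftE k v : base_left k v = if col v then left k v else left k (prv v).
Proof.
rewrite /base_left exterior_sum; last by move=> e _ /andP[/andP[]].
have cv : col v = ~~ col (prv v) by rewrite -{1}[v]nxt_prv col_nxt.
by rewrite !base_out -!/(left _ _) cv; case: (col _); rewrite ?addbF.
Qed.

(* The number of exterior edges oriented towards each vertex balances on either
   side of a chord, which forces its two ends to be matched on the same side. *)
Let base_left_const k u v : k < N -> u \in chord k -> v \in chord k ->
  base_left k u = base_left k v.
Proof.
move=> ltk; have [/edgesP[x [y [xy cxy]]] _] := chordP ltk.
suff E : base_left k x = base_left k y.
  by rewrite cxy !inE => /orP[]/eqP-> /orP[]/eqP->; rewrite ?E.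
have nxy : y != x by apply: contraTneq xy => ->; rewrite adj_irrefl.
have : \sum_w (left k w : nat) = \sum_w (left k (prv w) : nat).
  by rewrite [LHS](reindex_inj (can_inj (f_invF nxtI))).
rewrite (bigD1 x) // (bigD1 y) //= [in RHS](bigD1 x) // [in RHS](bigD1 y) //=.
rewrite [in RHS](eq_bigr (fun w => left k w : nat)); last first.
  move=> w /andP[nx ny]; have := left_sum w ltk.
  by rewrite cxy !inE (negPf nx) (negPf ny); case: (left k w) (left k (prv w)) => [] [].
have := left_sum x ltk; have := left_sum y ltk; rewrite cxy !inE !eqxx orbT.
have := proper_col lay xy; rewrite !base_leftE; move: (bigop _ _ _) => s.
case: (col x) (col y) => [] [] //= _.
all: case: (left k x) (left k y) (left k (prv x)) (left k (prv y)) => [] [] [] [] //= _ _; lia.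
Qed.

(* Whether the base matching covers the ends of the chord [k] from the side of
   the faces [0, ..., k]. *)
Definition chord_sign k : bool := [exists u in chord k, base_left k u].

Lemma chord_signE k u : k < N -> u \in chord k -> base_left k u = chord_sign k.
Proof.
move=> ltk uc; apply/idP/existsP => [bl|[v /andP[vc bl]]]; first by exists u; rewrite uc.
by rewrite (base_left_const ltk uc vc).
Qed.

Lemma join_left z k u : k < N -> u \in chord k ->
  degree_parity u (fun e => (e \in join z) && (pos e < k.*2.+1)) = chord_sign k (+) z k.
Proof.
move=> ltk uc; rewrite -(chord_signE ltk uc).
have := face_boundary_even lay (fun j => (j <= k) && z j) u.
rewrite (@eq_degree_parity _ _ _ (fun e => ((pos e < k.*2.+1) && face_sum z (pos e))
   (+) ((pos e == k.*2.+1) && z k))); last by move=> e _ _; rewrite face_sum_truncate.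
rewrite degree_parityD chord_sum // uc /= => E.
rewrite (@eq_degree_parity _ _ _ (fun e => (base_matching e && (pos e < k.*2.+1)) (+)
   ((pos e < k.*2.+1) && face_sum z (pos e)))).
  by rewrite degree_parityD; congr (_ (+) _); move: E; case: degree_parity (z k) => [] [].
by move=> e eE _; rewrite inE eE /=; case: (_ < _); rewrite ?andbT ?andbF ?addbF.
Qed.

Lemma chord_join z k : k < N -> (chord k \in join z) = (z k != z k.+1).
Proof.
move=> ltk; have [cE pc] := chordP ltk.
rewrite inE cE pc face_sum_odd /base_matching pc /= odd_double /=.
by case: (z k) (z k.+1) => [] [].
Qed.

(** A change in the wrong direction would match the chord and leave an odd number of matching edges
    on its left at each end, hence a second matching edge there. *)
Lemma join_pm_valid z : perfect_matching (edges G) (join z) -> valid chord_sign N z.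
Proof.
move=> pm k ltk; apply/negP=> /andP[/eqP zk /eqP zk1].
have [cE pc] := chordP ltk.
have [u uc] : exists u, u \in chord k.
  by apply/set0Pn; rewrite -card_gt0 card_edge.
have cJ : chord k \in join z by rewrite chord_join // zk zk1; case: chord_sign.
have := join_left z ltk uc; rewrite zk.
have -> : chord_sign k (+) ~~ chord_sign k = true by case: chord_sign.
case/degree_parity_ex=> e [eE ue /andP[eJ]].
by rewrite (pm_unique pm eJ cJ ue uc) pc ltnn.
Qed.
Let one_exterior_left k v e f : k < N -> v \in chord k ->
  e \in edges G -> f \in edges G -> v \in e -> v \in f -> ~~ odd (pos e) -> ~~ odd (pos f) ->
  (pos e < k.*2.+1) = (pos f < k.*2.+1) -> e = f.
Proof.
move=> ltk vc eE fE ve vf oe of_; have := left_sum v ltk; rewrite vc /left => lr.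
have cases g : g \in edges G -> v \in g -> ~~ odd (pos g) -> g = out v \/ g = out (prv v).
  move=> gE vg /(exterior_nxt lay gE)[w gw]; move: vg; rewrite gw !inE.
  by case/orP=> /eqP ->; [left|right; rewrite /prv invF_f].
by case: (cases e eE ve oe) (cases f fE vf of_) => -> [] -> // E; move: lr; rewrite E addbb.
Qed.

Lemma valid_join_pm z : valid chord_sign N z -> perfect_matching (edges G) (join z).
Proof.
move=> zV; apply/andP; split; first by apply/subsetP=> e; rewrite inE => /andP[].
apply/forallP=> v; have JE e : e \in join z -> e \in edges G by rewrite inE => /andP[].
have chord_pos e : e \in edges G -> odd (pos e) ->
    exists k, [/\ k < N, e = chord k & pos e = k.*2.+1].
  move=> eE oe; have := pos_max lay eE; have pe : pos e = (pos e)./2.*2.+1 by lia.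
  have ltk : (pos e)./2 < N by have := pos_max lay eE; lia.
  by exists (pos e)./2; split=> //; apply: chordE.
(* A valid change of letter has [z k = chord_sign k], which makes the parity of [join_left] even. *)
have leftJ k : k < N -> v \in chord k -> chord k \in join z ->
    degree_parity v (fun e => (e \in join z) && (pos e < k.*2.+1)) = false.
  move=> ltk vc; rewrite chord_join // join_left //; have := zV k ltk.
  by case: (z k) (z k.+1) (chord_sign k) => [] [] [].
pose D := [pred e | [&& e \in join z, v \in e & odd (pos e)]].
have card1 e : e \in join z -> v \in e -> (forall f, f \in join z -> v \in f -> f = e) ->
    #|[set e in join z | v \in e]| == 1.
  move=> eJ ve E; apply/cards1P; exists e; apply/setP=> f; rewrite !inE.
  apply/andP/eqP => [[fJ vf]|->]; last by move: eJ; rewrite inE.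
  by apply: E => //; rewrite inE.
have [e [eE ve eJ]] := degree_parity_ex (join_degree z v).
have [/existsP[g0 Dg0]|/existsPn noD] := boolP [exists g, D g]; last first.
  have evJ f : f \in join z -> v \in f -> ~~ odd (pos f).
    by move=> fJ vf; have := noD f; rewrite /= fJ vf.
  apply: (card1 e) => // f fJ vf; apply/eqP; apply: contraT => nfe.
  have := join_degree z v.
  rewrite (degree_parity2 eE ve (JE _ fJ) vf) ?eJ ?fJ // => g gE vg n1 n2.
  apply/negP=> gJ.
  have cases h : h \in edges G -> v \in h -> ~~ odd (pos h) -> h = out v \/ h = out (prv v).
    move=> hE vh /(exterior_nxt lay hE)[w hw]; move: vh; rewrite hw !inE.
    by case/orP=> /eqP ->; [left|right; rewrite /prv invF_f].
  move: n1 n2 nfe; case: (cases e eE ve (evJ _ eJ ve)) (cases f (JE _ fJ) vf (evJ _ fJ vf))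
    (cases g gE vg (evJ _ gJ vg)) => -> [] -> [] ->; by rewrite ?eqxx.
case: (arg_maxnP pos Dg0) => g /and3P[gJ vg og] gmax.
have [k [ltk gc pg]] := chord_pos g (JE _ gJ) og.
have vc : v \in chord k by rewrite -gc.
have cJ : chord k \in join z by rewrite -gc.
have lg := leftJ k ltk vc cJ.
(* A second chord would leave exactly one edge of the join between the last two. *)
have onlyg f : D f -> f = g.
  move=> Df; apply/eqP; apply: contraT => nfg.
  have Df' : (D f && (f != g)) by rewrite Df.
  case: (arg_maxnP (P := [pred f | D f && (f != g)]) pos Df') => g' /andP[/and3P[g'J vg' og'] ng'] g'max.
  have [k' [ltk' gc' pg']] := chord_pos g' (JE _ g'J) og'.
  have vc' : v \in chord k' by rewrite -gc'.
  have cJ' : chord k' \in join z by rewrite -gc'.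
  have ltg : pos g' < pos g.
    have leg : pos g' <= pos g by apply: gmax; rewrite /= g'J vg' og'.
    rewrite ltn_neqAle leg andbT; apply: contraNneq ng' => pE.
    by apply/eqP/(chord_unique lay) => //; apply: JE.
  have := leftJ k' ltk' vc' cJ'.
  have : degree_parity v (fun e => ((e \in join z) && (pos e < k.*2.+1)) (+)
      ((e \in join z) && (pos e < k'.*2.+1))).
    rewrite (degree_parity1 (JE _ g'J) vg') ?g'J /= -?pg -?pg' ?ltg ?ltnn // => h hE vh nh.
    case hJ: (h \in join z) => //=; case oh: (odd (pos h)); last first.
      have [hk|hk] := ltnP (pos h) (pos g'); first by rewrite (ltn_trans hk ltg).
      apply/negbTE/negP; rewrite addbF => hkg.
      (* Some exterior edge [h'] at [v] lies left of [g']; if [h] were between [g'] and [g], both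
         exterior edges at [v] would lie left of [g]. *)
      have [h' [h'E vh' /andP[oh' lh'] _]] : exists h', [/\ h' \in edges G, v \in h',
          ~~ odd (pos h') && (pos h' < k'.*2.+1) & true].
        have := left_sum v ltk'; rewrite vc' /left.
        case: ltnP => [l1 _|_]; first by exists (out v); rewrite set21 (nxt_exterior lay).
        move=> /= l1; exists (out (prv v)); split=> //; first by rewrite -{1}[v]nxt_prv set22.
        by rewrite (nxt_exterior lay).
      have E : h' = h.
        apply: (one_exterior_left ltk vc) => //; first by rewrite oh.
        by rewrite -pg hkg (ltn_trans _ ltg) // pg'.
      by move: hk; rewrite -E pg' leqNgt lh'.
    have [->|nhg] := eqVneq h g; first by rewrite ltnn ltnNge (ltnW ltg).
    have : pos h <= pos g' by apply: g'max; rewrite /= hJ vh oh nhg.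
    rewrite leq_eqVlt => /orP[/eqP pE|lt].
      by move: nh; rewrite (chord_unique lay hE (JE _ g'J) oh pE) eqxx.
    by rewrite lt (ltn_trans lt ltg).
  by rewrite degree_parityD lg /= => ->.
apply: (card1 g) => // f fJ vf.
case of_: (odd (pos f)); first by apply: onlyg; rewrite /= fJ vf of_.
(* The two exterior edges at [v] lie on both sides of [g]. *)
have sides h h' : h \in join z -> v \in h -> ~~ odd (pos h) ->
    h' \in join z -> v \in h' -> ~~ odd (pos h') ->
    (pos h < k.*2.+1) = (pos h' < k.*2.+1) -> h = h'.
  by move=> hJ vh oh h'J vh' oh'; apply: (one_exterior_left ltk vc); rewrite ?JE.
have [lf|lf] := boolP (pos f < k.*2.+1).
  move: lg; rewrite (degree_parity1 (JE _ fJ) vf) ?fJ ?lf // => h hE vh nh.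
  apply: contraNF nh => /andP[hJ lh]; apply/eqP.
  case oh: (odd (pos h)).
    by move: lh; rewrite (onlyg h) ?pg ?ltnn //= hJ vh oh.
  by apply: sides; rewrite ?oh ?of_ ?lh ?lf.
have := join_degree z v.
rewrite (@eq_degree_parity _ _ _ (fun e => ((e \in join z) && (pos e < k.*2.+1)) (+)
   ((e \in join z) && (k.*2.+1 <= pos e)))); last first.
  by move=> h _ _; case: (h \in _) => //=; case: ltnP.
rewrite degree_parityD lg (degree_parity2 (JE _ gJ) vg (JE _ fJ) vf).
- by rewrite gJ fJ pg leqnn leqNgt lf.
- by apply: contraFneq of_ => ->.
move=> h hE vh n1 n2; apply: contraNF n2 => /andP[hJ lh]; apply/eqP.
case oh: (odd (pos h)); first by move: n1; rewrite (onlyg h) ?eqxx //= hJ vh oh.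
by apply: sides; rewrite ?oh ?of_ // (negPf lf) ltnNge lh.
Qed.

(** * Faces whose exterior edges are all matched *)

Definition no_exterior k b : bool :=
  (k <= N) && [forall e in edges G, (pos e == k.*2) ==> (base_matching e != b)].

Let face_edge k e := face_sum (fun j => j == k) (pos e).

Let face_other k v e : e \in edges G -> v \in e -> face_edge k e ->
  exists f, [/\ f \in edges G, v \in f, face_edge k f & f != e].
Proof.
move=> eE ve fe; apply: (degree_parity_other _ eE ve fe).
exact: face_boundary_even lay _ v.
Qed.

(* If all the exterior edges of a face are matched, each end of a matched edge
   [e] of the face meets a chord of the face different from [e]. *)
Let face_all_matched k M e c : perfect_matching (edges G) M ->
  (forall f, f \in edges G -> pos f = k.*2 -> f \in M) ->
  e \in M -> face_edge k e -> c \in edges G ->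
  (forall f, f \in edges G -> face_edge k f -> odd (pos f) -> f != e -> f = c) -> False.
Proof.
move=> pm out_M eM fe cE uc; have eE := subsetP (pm_sub pm) _ eM.
have sub w : w \in e -> w \in c /\ c != e.
  move=> we; have [f [fE wf ff nfe]] := face_other eE we fe.
  have [of_|ef] := boolP (odd (pos f)); first by rewrite -(uc f).
  have fM : f \in M.
    by apply: out_M => //; move: ff ef; rewrite /face_edge face_sum_single; lia.
  by move: nfe; rewrite (pm_unique pm fM eM wf we) eqxx.
have ec : e = c.
  by apply/eqP; rewrite eqEcard !card_edge // leqnn andbT; apply/subsetP=> w /sub[].
have /set0Pn[w we] : e != set0 by rewrite -card_gt0 card_edge.
by have [_] := sub w we; rewrite ec eqxx.
Qed.

(** In each excluded case some valid word matches all exterior edges of the face and leaves at most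
    one chord to meet the ends of a matched edge, against [face_all_matched]. *)
Lemma no_exteriorP k b : no_exterior k b ->
  [/\ 0 < k, k < N, chord_sign k.-1 = b & chord_sign k = ~~ b].
Proof.
case/andP=> lek /forall_inP noE.
have ext_join z : z k = b -> forall f, f \in edges G -> pos f = k.*2 -> f \in join z.
  move=> zk f fE pf; rewrite inE fE pf face_sum_even zk.
  by have := noE f fE; rewrite pf eqxx /=; move: (b); clear; case: base_matching => [] [].
have constV : valid chord_sign N (fun=> b).
  by move=> j _; move: (chord_sign j) (b) => [] [].
have chord_face j : j < N -> (j == k) || (j.+1 == k) -> face_edge k (chord j).
  move=> ltj jk; have [_ pc] := chordP ltj.
  by rewrite /face_edge face_sum_single pc; move: jk; clear; lia.
(* An end face without exterior edges would have a single chord as boundary, but boundaries have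
   even degrees. *)
have ext_ex v : (exists e, [/\ e \in edges G, v \in e & face_edge k e]) ->
    (k == 0) || (k == N) -> exists2 e, e \in edges G & pos e = k.*2.
  case=> e [eE ve fe] kk; case: (pickP [pred f | (f \in edges G) && (pos f == k.*2)]) => [f /andP[fE /eqP]|no].
    by exists f.
  have [f [fE vf ff nfe]] := face_other eE ve fe.
  have odd_face h : h \in edges G -> face_edge k h -> odd (pos h).
    by move=> hE; have := no h; rewrite /= hE /face_edge face_sum_single => /= ->; lia.
  have := pos_max lay fE; have := pos_max lay eE.
  have oe := odd_face _ eE fe; have of_ := odd_face _ fE ff.
  have : pos e != pos f by apply: contraNneq nfe => E; rewrite (chord_unique lay eE fE oe E).
  by move: fe ff oe of_ kk; rewrite /face_edge !face_sum_single; clear; lia.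
have odd_face f : f \in edges G -> face_edge k f -> odd (pos f) ->
    (k < N /\ f = chord k) \/ (0 < k /\ f = chord k.-1).
  move=> fE ff of_; have lef := pos_max lay fE.
  have [pf|pf] := eqVneq (pos f) k.*2.+1.
    have ltk : k < N by lia.
    by left; split=> //; apply: chordE.
  right; move: ff; rewrite /face_edge face_sum_single (negPf pf) => ff.
  have k0 : 0 < k by move: ff of_; clear; lia.
  by split=> //; apply: chordE => //; [lia|move: ff of_ k0; clear; lia].
have pmb := valid_join_pm constV.
have mid e c : e \in edges G -> pos e = k.*2 -> c \in edges G ->
    (forall f, f \in edges G -> face_edge k f -> odd (pos f) -> f = c) -> False.
  move=> eE pe cE uc; apply: (face_all_matched pmb (ext_join _ erefl) _ _ cE) => [||f fE ff of_ _].
  - exact: ext_join erefl _ eE pe.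
  - by rewrite /face_edge face_sum_single pe eqxx.
  - exact: uc.
have endpoint e : e \in edges G -> exists v, v \in e.
  by move=> eE; apply/set0Pn; rewrite -card_gt0 card_edge.
have k0 : 0 < k.
  rewrite lt0n; apply/eqP=> k0; have [N0|N0] := posnP N.
    have /card_gt0P[v _] := layout_inhabited lay.
    have pv : pos (out v) = k.*2 by have := pos_max lay (outE v); rewrite N0 k0; lia.
    apply: (mid _ _ (outE v) pv (outE v)) => f fE _.
    by have := pos_max lay fE; rewrite N0; case: (pos f).
  have [cE _] := chordP N0; have [v vc] := endpoint _ cE.
  have [||e eE pe] := ext_ex v; [|by rewrite k0|].
    by exists (chord 0); split=> //; apply: chord_face; rewrite ?k0.
  apply: (mid _ _ eE pe cE) => f fE ff of_.
  by case: (odd_face f fE ff of_) => -[]; rewrite k0.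
have ltk1 : k.-1 < N by move: lek k0; clear; lia.
have [c1E _] := chordP ltk1.
have fc1 : face_edge k (chord k.-1) by apply: chord_face; rewrite // prednK // eqxx orbT.
have ltk : k < N.
  rewrite ltn_neqAle lek andbT; apply/eqP=> kN.
  have [v vc] := endpoint _ c1E.
  have [||e eE pe] := ext_ex v; [|by rewrite kN eqxx orbT|].
    by exists (chord k.-1).
  apply: (mid _ _ eE pe c1E) => f fE ff of_.
  by case: (odd_face f fE ff of_) => -[] //; rewrite kN ltnn.
have [cE _] := chordP ltk.
have fc : face_edge k (chord k) by apply: chord_face; rewrite ?eqxx.
split=> //.
- have [//|s1] := eqVneq (chord_sign k.-1) b; exfalso.
  (* With the other sign, this change of letter at the chord [k.-1] would be valid and would match
     that chord. *)
  pose z j := if j < k then ~~ b else b.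
  have zV : valid chord_sign N z.
    move=> j ltj; rewrite /z; have [ejk|nejk] := eqVneq j k.-1.
      have l1 : j < k by rewrite ejk prednK.
      have l2 : (j.+1 < k) = false by rewrite ejk prednK // ltnn.
      by rewrite l1 l2 ejk; move: s1; move: (chord_sign _) (b) => [] [].
    have -> : (j.+1 < k) = (j < k) by move: nejk k0; clear; lia.
    by case: ifP => _; move: (chord_sign j) (b) => [] [].
  have zk : z k = b by rewrite /z ltnn.
  case: (face_all_matched (valid_join_pm zV) (ext_join z zk) _ fc1 cE).
    by rewrite chord_join // prednK // zk /z prednK // leqnn; case: (b).
  by move=> f fE ff of_ nf; case: (odd_face f fE ff of_) => -[_ E] //; rewrite E eqxx in nf.
- have [//|s1] := eqVneq (chord_sign k) (~~ b); exfalso.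
  pose z j := if j <= k then b else ~~ b.
  have zV : valid chord_sign N z.
    move=> j ltj; rewrite /z; have [ejk|nejk] := eqVneq j k.
      by rewrite ejk leqnn ltnn; move: s1; move: (chord_sign _) (b) => [] [].
    have -> : (j < k) = (j <= k) by move: nejk; clear; lia.
    by case: ifP => _; move: (chord_sign j) (b) => [] [].
  have zk : z k = b by rewrite /z leqnn.
  case: (face_all_matched (valid_join_pm zV) (ext_join z zk) _ fc c1E).
    by rewrite chord_join // zk /z ltnn; case: (b).
  by move=> f fE ff of_ nf; case: (odd_face f fE ff of_) => -[_ E] //; rewrite E eqxx in nf.
Qed.

(** A face without exterior edges would satisfy [no_exterior] for both letters, which demand
    opposite signs. *)
Lemma exterior_ex k : k <= N -> exists2 e, e \in edges G & pos e = k.*2.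
Proof.
move=> lek; case: (pickP [pred e | (e \in edges G) && (pos e == k.*2)]) => [e /andP[eE /eqP]|no].
  by exists e.
have ne b : no_exterior k b.
  rewrite /no_exterior lek; apply/forall_inP=> e eE.
  by have := no e; rewrite /= eE => /= ->.
by have [_ _ _ E1] := no_exteriorP (ne true); have [_ _ _] := no_exteriorP (ne false); rewrite E1.
Qed.

Lemma eq_join z z' : (forall k, k <= N -> z k = z' k) -> join z = join z'.
Proof.
move=> E; apply/setP=> e; rewrite !inE; case eE: (e \in edges G) => //=.
congr (_ (+) _); apply: eq_face_sum => j lej; apply: E.
by have := pos_max lay eE; move: lej; clear; lia.
Qed.

(** * Anti-forcing numbers as costs of words *)

Lemma weightE occ n : weight occ n = #|[set p : 'I_n | occ p]|.
Proof.
rewrite /weight big_mkord -sum1_card [RHS]big_mkcond /=.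
by apply: eq_bigr => p _; rewrite inE; case: occ.
Qed.

(** The positions of [S] form a hitting set: a word that differs from [z] at none of them gives a
    perfect matching avoiding [S], hence [join z], and the exterior edges then recover every
    letter. *)
Lemma anti_forcing_weight z S : valid chord_sign N z -> anti_forcing_set (join z) S ->
  cost N chord_sign no_exterior z <= #|S|.
Proof.
move=> zV /andP[sS /forallP af].
have SE e : e \in S -> (e \in edges G) /\ e \notin join z.
  by move=> /(subsetP sS); rewrite inE => /andP[-> ->].
pose occ p := [exists e in S, pos e == p].
have wS : weight occ N.*2.+1 <= #|S|.
  rewrite weightE; apply: leq_trans (leq_imset_card (fun e => inord (pos e) : 'I_N.*2.+1) S).
  apply/subset_leq_card/subsetP=> p; rewrite inE => /exists_inP[e eS /eqP pe].
  by apply/imsetP; exists e => //; apply/val_inj; rewrite pe inord_val.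
apply: leq_trans wS; apply: (cost_hitting no_exteriorP zV).
  split=> k.
    move=> lek /exists_inP[e /SE[eE eJ] /eqP pe].
    apply/negP=> /andP[_ /forall_inP/(_ e eE)]; rewrite pe eqxx /=.
    by move: eJ; rewrite inE eE pe face_sum_even; case: base_matching (z k) => [] [].
  move=> ltk /exists_inP[e /SE[eE eJ] /eqP pe].
  by move: eJ; rewrite (chordE ltk eE pe) chord_join // negbK => /eqP.
move=> D DV DU.
have E : join (fun k => z k (+) D k) = join z.
  apply/eqP; rewrite -(eqP (af _)); have /andP[sJ pJ] := valid_join_pm DV.
  rewrite /perfect_matching pJ andbT; apply/subsetP=> e eJ.
  rewrite inE (subsetP sJ) // andbT; apply/negP=> eS.
  have [eE] := SE e eS; have := DU (pos e) (pos_max lay eE).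
  have -> : occ (pos e) by apply/exists_inP; exists e.
  move=> /(_ isT) /negPf D0; rewrite inE eE /=.
  by move: eJ; rewrite inE eE face_sumD D0 addbF /= => ->.
move=> k lek; have [e eE pe] := exterior_ex lek.
have : (e \in join (fun k => z k (+) D k)) = (e \in join z) by rewrite E.
rewrite !inE eE pe !face_sum_even /=.
by case: base_matching (z k) (D k) => [] [] [].
Qed.

(** One unmatched edge for each occupied position is enough, as the edges at a position are flipped
    together. *)
Lemma anti_forcing_attained z : valid chord_sign N z ->
  exists2 S, anti_forcing_set (join z) S & #|S| <= cost N chord_sign no_exterior z.
Proof.
move=> zV; have [occ [[occe occo] hit <-]] := cost_attained no_exteriorP zV.
pose pck (p : nat) := odflt set0 [pick e in edges G :\: join z | pos e == p].
have pckP p : p <= N.*2 -> occ p -> pck p \in edges G :\: join z /\ pos (pck p) = p.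
  move=> lep op; rewrite /pck; case: pickP => [e /andP[eE /eqP]|no] //=.
  have [odp|odp] := boolP (odd p).
    have ltk : p./2 < N by move: lep odp; clear; lia.
    have pE : p = p./2.*2.+1 by move: odp; clear; lia.
    have [cE pc] := chordP ltk.
    have := no (chord p./2); rewrite pc -pE eqxx inE cE chord_join // !andbT negbK.
    by rewrite occo ?eqxx // -pE.
  have lek : p./2 <= N by move: lep; clear; lia.
  have pE : p = p./2.*2 by move: odp; clear; lia.
  have : ~~ no_exterior p./2 (z p./2) by apply: occe; rewrite // -pE.
  rewrite /no_exterior lek /= negb_forall_in => /exists_inP[e eE].
  rewrite negb_imply negbK -pE => /andP[/eqP pe /eqP be].
  have := no e; rewrite pe eqxx !inE eE pe {1}pE face_sum_even be.
  by rewrite addbb.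
exists [set pck p | p : 'I_N.*2.+1 in [set p : 'I_N.*2.+1 | occ p]]; last first.
  by rewrite weightE leq_imset_card.
have sS : [set pck p | p : 'I_N.*2.+1 in [set p : 'I_N.*2.+1 | occ p]] \subset edges G :\: join z.
  apply/subsetP=> e /imsetP[p]; rewrite inE => op ->.
  by case: (pckP p (ltnSE (ltn_ord p)) op).
apply/andP; split=> //; apply/forallP=> M; apply/eqP.
have pJ := valid_join_pm zV.
apply/idP/eqP => [pM|->]; last first.
  case/andP: pJ => sJ pJ; rewrite /perfect_matching pJ andbT.
  apply/subsetP=> e eJ; rewrite inE (subsetP sJ) // andbT; apply/negP=> /(subsetP sS).
  by rewrite inE eJ.
have pM' : perfect_matching (edges G) M.
  case/andP: pM => sM pM; rewrite /perfect_matching pM andbT.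
  by apply: subset_trans sM _; apply: subsetDl.
have [w Mw] := pm_join pM'; rewrite Mw in pM pM' *.
have wV := join_pm_valid pM'.
pose D k := z k (+) w k.
have DE k : z k (+) D k = w k by rewrite /D addbA addbb.
have D0 : forall k, k <= N -> D k = false.
  apply: hit => [k ltk|p lep op]; first by rewrite !DE wV.
  have [] := pckP p lep op; rewrite inE => /andP[eJ eE] pp.
  have : pck p \notin join w.
    apply/negP=> /(subsetP (proj1 (andP pM))); rewrite inE => /andP[/negP nS _]; apply: nS.
    by apply/imsetP; exists (inord p); rewrite ?inE ?inordK.
  move: eJ; rewrite !inE eE pp /= /D face_sumD.
  by case: base_matching (face_sum z p) (face_sum w p) => [] [] [].
by apply: eq_join => k lek; rewrite -DE D0 // addbF.
Qed.

Lemma af_join z : valid chord_sign N z -> af (join z) = cost N chord_sign no_exterior z.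
Proof.
move=> zV; rewrite /af; case: arg_minnP => [|S afS minS].
  exact/anti_forcing_setC/valid_join_pm.
have [S' afS' leS'] := anti_forcing_attained zV.
by apply/eqP; rewrite eqn_leq anti_forcing_weight // (leq_trans (minS _ afS') leS').
Qed.

Lemma layout_spectrum_convex : convex (fun n => n \in af_spectrum G).
Proof.
apply: eq_convex (convex_cost no_exteriorP) => n; split.
  case=> z zV ->; apply/existsP; exists (join z).
  by rewrite valid_join_pm //= af_join.
case/existsP=> M /andP[pM /eqP <-]; have [z Mz] := pm_join pM; rewrite Mz in pM *.
by exists z; [exact: join_pm_valid|exact/af_join/join_pm_valid].
Qed.

End Layout.

Lemma convex_interval (P : pred nat) b : convex (fun n => n \in P) ->
  (forall n, n \in P -> n <= b) -> exists c d, forall n, (n \in P) = (c <= n <= d).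
Proof.
move=> cP Pb; have bP n : P n -> n <= b by apply: Pb.
case: (pickP [pred n : 'I_b.+1 | P n]) => [n0 /= Pn0|no].
  have exP : exists n, P n by exists n0.
  exists (ex_minn exP), (ex_maxn exP bP) => n.
  case: ex_minnP => c Pc cmin; case: ex_maxnP => d Pd dmax.
  by apply/idP/idP => [Pn|]; [rewrite cmin ?dmax|apply: cP].
(* The empty set, as for a graph without perfect matching, is the interval from 1 to 0. *)
exists 1, 0 => n; apply/idP/idP=> [Pn|]; last by case: n.
have := no (inord n); rewrite /= inordK ?ltnS ?Pb //.
by move: Pn; rewrite unfold_in => ->.
Qed.

Lemma af_spectrum_bounded (G : sgraph) n : n \in af_spectrum G -> n <= #|edges G|.
Proof.
case/existsP=> M /andP[pM /eqP <-]; rewrite /af.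
case: arg_minnP => [|S /andP[sS _] _]; first exact: anti_forcing_setC.
exact/subset_leq_card/(subset_trans sS)/subsetDl.
Qed.

(** * Even edge sets are sums of face boundaries *)

Section Darts.
Variable G : sgraph.
Implicit Types d : dart G.

Lemma dart_revK : involutive (@dart_rev G).
Proof. by move=> d; apply/val_inj; case: d => [[x y] xy]. Qed.

Lemma dart_edge_rev d : dart_edge (dart_rev d) = dart_edge d.
Proof. by rewrite /dart_edge setUC. Qed.

Lemma adj_dart d : adj (source d) (target d).
Proof. exact: valP d. Qed.

Lemma source_neq_target d : source d != target d.
Proof. by apply: contraTneq (adj_dart d) => ->; rewrite adj_irrefl. Qed.

Lemma adj_dart_ex (x y : G) : adj x y -> exists d, source d = x /\ target d = y.
Proof. by move=> xy; exists (exist (fun p : G * G => adj p.1 p.2) (x, y) xy). Qed.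

Lemma dart_eq d d' : source d = source d' -> target d = target d' -> d = d'.
Proof.
move=> es et; apply/val_inj; rewrite [val d]surjective_pairing [val d']surjective_pairing.
by congr (_, _).
Qed.

Lemma dart_edge_in d : dart_edge d \in edges G.
Proof. by apply/edgesP; exists (source d), (target d); split; [exact: adj_dart|]. Qed.

Lemma dart_edge_inj d d' : dart_edge d = dart_edge d' -> d' = d \/ d' = dart_rev d.
Proof.
move=> E; have : source d' \in dart_edge d by rewrite E set21.
have : target d' \in dart_edge d by rewrite E set22.
have := source_neq_target d'; rewrite !inE => n /orP[]/eqP et /orP[]/eqP es.
- by rewrite es et eqxx in n.
- by right; apply: dart_eq.
- by left; apply: dart_eq.
- by rewrite es et eqxx in n.
Qed.

Lemma edge_dart e : e \in edges G -> exists d, dart_edge d = e.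
Proof.
by case/edgesP=> x [y [/adj_dart_ex[d [<- <-]] ->]]; exists d.
Qed.

Lemma big_edges_at (R : Type) (idx : R) (op : Monoid.com_law idx) (v : G)
    (F : {set G} -> R) :
  \big[op/idx]_(e in edges G | v \in e) F e =
  \big[op/idx]_(d : dart G | source d == v) F (dart_edge d).
Proof.
transitivity (\big[op/idx]_(e in [set dart_edge d | d in [set d : dart G | source d == v]]) F e).
  apply: eq_bigl => e; apply/idP/imsetP => [/andP[/edge_dart[d <-]]|[d]].
    rewrite !inE => /orP[]/eqP E; first by exists d; rewrite ?inE ?E.
    by exists (dart_rev d); rewrite ?dart_edge_rev // inE E.
  by rewrite inE => /eqP <- ->; rewrite dart_edge_in set21.
rewrite big_imset /=; first by apply: eq_bigl => d; rewrite inE.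
move=> d d'; rewrite !inE => /eqP sd /eqP sd' /dart_edge_inj[//|E].
by have := source_neq_target d; rewrite sd -sd' E eqxx.
Qed.

Lemma dart_rev_neq d : dart_rev d != d.
Proof.
by apply: contraTneq (source_neq_target d) => E; rewrite -{1}E eqxx.
Qed.

Lemma big_dart_edge (R : Type) (idx : R) (op : Monoid.com_law idx) d (f : dart G -> R) :
  \big[op/idx]_(c : dart G | dart_edge c == dart_edge d) f c = op (f d) (f (dart_rev d)).
Proof.
rewrite (bigD1 d) ?eqxx //= (bigD1 (dart_rev d)) /=; last first.
  by rewrite dart_edge_rev eqxx dart_rev_neq.
rewrite big1 ?Monoid.mulm1 // => c /andP[/andP[/eqP ec nd] nrd].
by case: (dart_edge_inj (esym ec)) => E; move: nd nrd; rewrite E eqxx.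
Qed.

End Darts.

Section Map.
Variables (G : sgraph) (rot : {perm dart G}).
Hypothesis rotP : rotation_system rot.
Implicit Types d : dart G.

Definition face d : {set dart G} := porbit (face_perm rot) d.

Lemma source_rot d : source (rot d) = source d.
Proof.
by apply/eqP; rewrite -rotP; have := mem_porbit rot 1 d; rewrite expg1.
Qed.

Lemma face_permE d : face_perm rot d = rot (dart_rev d).
Proof. by rewrite permM permE. Qed.

Lemma source_face_perm d : source (face_perm rot d) = target d.
Proof. by rewrite face_permE source_rot. Qed.

Lemma face_face_perm d : face (face_perm rot d) = face d.
Proof. by have := porbit_perm (face_perm rot) 1 d; rewrite expg1. Qed.

Lemma face_rot d : face (rot d) = face (dart_rev d).
Proof. by rewrite -[RHS]face_face_perm face_permE dart_revK. Qed.

Lemma mem_face d : d \in face d. Proof. exact: porbit_id. Qed.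

Lemma eq_face d d' : (face d == face d') = (d \in face d').
Proof. exact: eq_porbit_mem. Qed.

Lemma facesP F : reflect (exists d, F = face d) (F \in faces rot).
Proof. by apply: (iffP imsetP) => [[d _ ->]|[d ->]]; exists d. Qed.

Lemma face_of F d : F \in faces rot -> d \in F -> F = face d.
Proof. by case/facesP=> d' -> dF; apply/eqP; rewrite eq_sym eq_face. Qed.

(** [P] is either all vertices, for functions on faces, or all but one, when rotation at that vertex
    may change the value. *)
Lemma constant_on_darts (P : pred G) (T : Type) (g : dart G -> T) :
  (forall d, g (dart_rev d) = g d) ->
  (forall d, P (source d) -> g (rot d) = g d) ->
  forall d d', P (source d) ->
    connect [rel a b | [&& adj a b, P a & P b]] (source d) (source d') -> g d = g d'.
Proof.
move=> grev grot.
have same d d' : P (source d) -> source d' = source d -> g d' = g d.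
  move=> Pd sd; have : d' \in porbit rot d by rewrite rotP sd.
  case/porbitP=> i ->; elim: i => [|i IH]; first by rewrite expg0 perm1.
  rewrite expgSr permM grot //.
  have : (rot ^+ i)%g d \in porbit rot d by rewrite mem_porbit.
  by rewrite rotP => /eqP ->.
move=> d d' Pd /connectP[p]; elim: p d Pd => [|x p IH] d Pd /=.
  by move=> _ E; rewrite (same d d').
case/andP=> /and3P[dx _ Px] pp E; have [c [cs ct]] := adj_dart_ex dx.
have sc : source (dart_rev c) = x by rewrite -ct.
rewrite -(same d c Pd cs) -grev; apply: IH; by rewrite sc.
Qed.

Hypothesis conG : connected G.

(** The dual of a connected map is connected: around a vertex, consecutive darts lie on faces that
    share an edge. *)
Lemma face_function_const (T : Type) (h : {set dart G} -> T) :
  (forall d, h (face d) = h (face (dart_rev d))) -> forall d d', h (face d) = h (face d').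
Proof.
move=> hrev d d'.
apply: (@constant_on_darts xpredT _ (fun d => h (face d))) => [x|x _||].
- by rewrite [RHS]hrev.
- by rewrite face_rot -hrev.
- by [].
- rewrite (@eq_connect _ _ (@adj G)); first exact: conG.
  by move=> a b /=; rewrite andbT.
Qed.

Import GRing.Theory.
Local Open Scope ring_scope.

Let F2 := 'F_2.

Let F2_add (x y : F2) : x + y = 0 -> x = y.
Proof. by case: x y => [[|[|//]] ?] [[|[|//]] ?] // _; apply/val_inj. Qed.

Let F2_double (x : F2) : x + x = 0.
Proof. by case: x => [[|[|//]] ?]; apply/val_inj. Qed.

Let F2_parity (c : bool) (x y : F2) : c%:R = x + y -> c = (x != 0) (+) (y != 0).
Proof. by case: x y => [[|[|//]] ?] [[|[|//]] ?] /(congr1 val); case: c. Qed.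

Let inc : 'M[F2]_(#|G|, #|edges G|) := \matrix_(i, j) ((enum_val i : G) \in (enum_val j : {set G}))%:R.

(** Summing over both darts of an edge gives 0 for an edge that its face traverses twice. *)
Let bnd : 'M[F2]_(#|faces rot|, #|edges G|) :=
  \matrix_(i, j) \sum_(d : dart G | dart_edge d == enum_val j) (d \in (enum_val i : {set dart G}))%:R.

Let coef (w : 'rV[F2]_#|faces rot|) (F : {set dart G}) : F2 :=
  \sum_(i | enum_val i == F) w 0 i.

Let edge_coef w (e : {set G}) : F2 := \sum_(d : dart G | dart_edge d == e) coef w (face d).

Let bnd_row w j : (w *m bnd) 0 j = edge_coef w (enum_val j).
Proof.
rewrite mxE; under eq_bigr => i _ do rewrite mxE big_distrr /=.
rewrite exchange_big; apply: eq_bigr => c _ /=; rewrite /coef [RHS]big_mkcond /=.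
apply: eq_bigr => i _; have := @face_of _ c (enum_valP i).
case ci: (c \in enum_val i); first by move=> ->; rewrite // eqxx mulr1.
by move=> _; rewrite mulr0; case: eqP => // E; rewrite E mem_face in ci.
Qed.

Let edge_coefE w d : edge_coef w (dart_edge d) = coef w (face d) + coef w (face (dart_rev d)).
Proof. exact: big_dart_edge. Qed.

Let sum_edges_at v (f : {set G} -> F2) :
  \sum_(j : 'I_#|edges G|) f (enum_val j) * (v \in (enum_val j : {set G}))%:R =
  \sum_(e in edges G | v \in e) f e.
Proof.
rewrite big_mkcondr [RHS]big_enum_val /=.
by apply: eq_bigr => j _; case: (v \in _); rewrite ?mulr1 ?mulr0.
Qed.

(** Around a vertex, rotation turns the sum over the faces of the darts into the sum over the faces
    of their reverses; the two cancel in characteristic 2. *)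
Let bnd_inc : bnd *m inc^T = 0.
Proof.
suff H (w : 'rV_#|faces rot|) : w *m bnd *m inc^T = 0.
  by apply/row_matrixP=> i; rewrite row_mul rowE H row0.
apply/rowP=> i; rewrite !mxE; under eq_bigr => j _ do rewrite bnd_row !mxE.
rewrite sum_edges_at big_edges_at; under eq_bigr => d _ do rewrite edge_coefE -face_rot.
rewrite big_split /= [X in _ + X](reindex_inj (perm_inj (s := rot^-1%g))) /=.
rewrite [X in _ + X](eq_big (fun d => source d == enum_val i) (fun d => coef w (face d))).
- exact: F2_double.
- by move=> d; rewrite -[d in RHS](permKV rot) source_rot.
- by move=> d _; rewrite permKV.
Qed.

(** Connectedness leaves only constant vectors in the left kernel; [bnd_rank] is the dual
    argument. *)
Let inc_rank : (#|G| <= (\rank inc).+1)%N.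
Proof.
have ker1 : (kermx inc <= (const_mx 1 : 'rV_#|G|))%MS.
  apply/rV_subP=> u /sub_kermxP uA.
  have uE x y : adj x y -> u 0 (enum_rank x) = u 0 (enum_rank y).
    move=> xy; have exy : [set x; y] \in edges G by apply/edgesP; exists x, y.
    have nxy : x \notin [set y] by rewrite inE; apply: contraTneq xy => ->; rewrite adj_irrefl.
    have := congr1 (fun M : 'rV[F2]_#|edges G| => M 0 (enum_rank_in exy [set x; y])) uA.
    rewrite !mxE; under eq_bigr => i _ do rewrite mxE enum_rankK_in //.
    rewrite (reindex_onto enum_rank enum_val) => [|i _]; last exact: enum_valK.
    under eq_bigl => v do rewrite enum_rankK eqxx.
    under eq_bigr => v _ do rewrite enum_rankK.
    rewrite (eq_bigr (fun v => if v \in [set x; y] then u 0 (enum_rank v) else 0)); last first.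
      by move=> v _; case: ifP; rewrite ?mulr1 ?mulr0.
    by rewrite -big_mkcond big_setU1 //= big_set1 => /F2_add.
  have uc x y : u 0 (enum_rank x) = u 0 (enum_rank y).
    case/connectP: (conG x y) => p; elim: p x => [|z p IH] x /=; first by move=> _ ->.
    by case/andP=> /uE-> pp E; apply: IH.
  case: (pickP (mem 'I_#|G|)) => [i0 _|no]; last first.
    by rewrite (_ : u = 0) ?sub0mx //; apply/rowP=> i; have := no i.
  suff -> : u = u 0 i0 *: const_mx 1 by apply: scalemx_sub.
  apply/rowP=> i; rewrite !mxE mulr1 -(enum_valK i) -(enum_valK i0); exact: uc.
have := leq_trans (mxrankS ker1) (rank_leq_row _).
by rewrite mxrank_ker leq_subLR addn1.
Qed.

Let bnd_rank : (#|faces rot| <= (\rank bnd).+1)%N.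
Proof.
have ker1 : (kermx bnd <= (const_mx 1 : 'rV_#|faces rot|))%MS.
  apply/rV_subP=> w /sub_kermxP wB.
  have wE i : w 0 i = coef w (enum_val i).
    rewrite /coef (big_pred1 i) // => j /=; apply/eqP/eqP => [/enum_val_inj//|->//].
  have h0 d : coef w (face d) = coef w (face (dart_rev d)).
    apply: F2_add; rewrite -edge_coefE.
    by rewrite -(enum_rankK_in (dart_edge_in d) (dart_edge_in d)) -bnd_row wB mxE.
  have hc := face_function_const h0.
  case: (pickP (mem 'I_#|faces rot|)) => [i0 _|no]; last first.
    by rewrite (_ : w = 0) ?sub0mx //; apply/rowP=> i; have := no i.
  suff -> : w = w 0 i0 *: const_mx 1 by apply: scalemx_sub.
  apply/rowP=> i; rewrite !mxE mulr1 !wE.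
  have /facesP[d ->] := enum_valP i; have /facesP[d' ->] := enum_valP i0.
  exact: hc.
have := leq_trans (mxrankS ker1) (rank_leq_row _).
by rewrite mxrank_ker leq_subLR addn1.
Qed.

Hypothesis euler : (#|G| + #|faces rot| = #|edges G| + 2)%N.

(* Euler's formula makes the ranks of the incidence and boundary matrices over
   F_2 add up to the number of edges, so that every even set of edges is a sum
   of face boundaries. *)
Lemma even_is_boundary (g : {set G} -> bool) : (forall v, degree_parity v g = false) ->
  exists h : {set dart G} -> bool,
    forall d, g (dart_edge d) = h (face d) (+) h (face (dart_rev d)).
Proof.
move=> g0; pose u : 'rV[F2]_#|edges G| := \row_j (g (enum_val j))%:R.
have cyc : (u <= kermx inc^T)%MS.
  apply/sub_kermxP/rowP=> i; rewrite !mxE.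
  under eq_bigr => j _ do rewrite !mxE.
  rewrite (sum_edges_at _ (fun e => (g e)%:R)).
  have addM : {morph (fun b : bool => b%:R : F2) : b c / b (+) c >-> b + c}.
    by case=> [] []; rewrite /= ?F2_double ?addr0 ?add0r.
  have := big_morph _ addM (mulr0n 1 : (false%:R : F2) = 0) (index_enum _)
    [pred e in edges G | enum_val i \in (e : {set G})] g.
  by move=> /= <-; have := g0 (enum_val i); rewrite /degree_parity => ->.
have sub : (bnd <= kermx inc^T)%MS by apply/sub_kermxP/bnd_inc.
have full : (kermx inc^T <= bnd)%MS.
  rewrite -(geq_leqif (mxrank_leqif_sup sub)) mxrank_ker mxrank_tr.
  by move: inc_rank bnd_rank euler; lia.
have /submxP[w uw] := submx_trans cyc full.
exists (fun F => coef w F != 0) => d.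
apply: F2_parity; rewrite -edge_coefE.
rewrite -(enum_rankK_in (dart_edge_in d) (dart_edge_in d)) -bnd_row -uw mxE.
by rewrite enum_rankK_in ?dart_edge_in.
Qed.

Local Close Scope ring_scope.

Hypothesis big3 : 2 < #|G|.
Hypothesis no_cut_vertex : forall v x y : G, x != v -> y != v ->
  connect [rel a b | [&& adj a b, a != v & b != v]] x y.

(* If a face passes twice through [v], the part of its boundary walk between two
   visits is a sum of face boundaries; this splits the edges at [v] into two
   classes that meet only at [v]. *)
Lemma face_source_inj x y : y \in face x -> source x = source y -> x = y.
Proof.
move=> yx sxy; apply/eqP; apply: contraT => nxy; set v := source x in sxy.
pose phi := face_perm rot; pose L := #|porbit phi x|.
have iter_inj j k : j < L -> k < L -> iter j phi x = iter k phi x -> j = k.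
  move=> ltj ltk E; have := uniq_traject_porbit phi x.
  move/uniqP=> /(_ x); rewrite size_traject => /(_ j k ltj ltk).
  by rewrite !nth_traject // => /(_ E).
have := yx; rewrite /face porbit_traject => /trajectP[i ltiL yi].
have i0 : 0 < i by rewrite lt0n; apply: contraNneq nxy => i0; rewrite yi i0.
(* The stretch of the boundary walk from [x] up to [y], with [y] excluded. *)
pose W d := d \in traject phi x i.
have Wx : W x by apply/trajectP; exists 0.
have Wy : W y = false.
  apply/negP=> /trajectP[j ltj E]; have := iter_inj i j ltiL (ltn_trans ltj ltiL).
  by rewrite -yi -E => /(_ erefl) ij; rewrite ij ltnn in ltj.
have Wpy : W (phi^-1 y)%g.
  apply/trajectP; exists i.-1; first by rewrite prednK.
  by apply/(perm_inj (s := phi)); rewrite permKV yi -iterS prednK.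
have Wpx : W (phi^-1 x)%g = false.
  apply/negP=> /trajectP[j ltj E]; have := iter_inj 0 j.+1 _ (leq_ltn_trans ltj ltiL).
  rewrite iterS -E permKV => /(_ _ erefl) H; suff: 0 = j.+1 by [].
  by apply: H; apply: leq_ltn_trans ltiL.
have Wphi d : d != x -> d != y -> W (phi^-1 d)%g = W d.
  move=> ndx ndy; apply/idP/idP => /trajectP[j ltj E].
    have dE : d = iter j.+1 phi x by rewrite iterS -E permKV.
    apply/trajectP; exists j.+1 => //; rewrite ltn_neqAle ltj andbT.
    by apply: contraNneq ndy => ji; rewrite dE ji -yi.
  case: j E ltj => [E|j E ltj]; first by rewrite E eqxx in ndx.
  apply/trajectP; exists j; first exact: ltnW.
  by apply/(perm_inj (s := phi)); rewrite permKV E iterS.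
pose g e := \big[addb/false]_(d : dart G | dart_edge d == e) W d.
have gE d : g (dart_edge d) = W d (+) W (dart_rev d) by apply: big_dart_edge.
have rotE d : dart_rev d = (phi^-1 (rot d))%g.
  by apply/(perm_inj (s := phi)); rewrite permKV face_permE dart_revK.
have [w|h hP] := @even_is_boundary g.
  rewrite /degree_parity big_edges_at; under eq_bigr => d _ do rewrite gE rotE.
  rewrite big_split /= [X in _ (+) X](reindex_inj (perm_inj (s := rot^-1%g))) /=.
  rewrite [X in _ (+) X](eq_big (fun d => source d == w) (fun d => W (phi^-1 d)%g)).
  - rewrite -big_split /=; have [wv|nwv] := eqVneq w v; last first.
      apply: big1 => d /eqP sd; rewrite Wphi ?addbb //.
        by apply: contraNneq nwv => dx; rewrite -sd dx eqxx.
      by apply: contraNneq nwv => dy; rewrite -sd dy sxy eqxx.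
    rewrite (bigD1 x) ?wv //= (bigD1 y) /=; last by rewrite -sxy eqxx eq_sym.
    rewrite Wx Wpx Wy Wpy big1 // => d /andP[/andP[_ ndx] ndy].
    by rewrite Wphi ?addbb.
  - by move=> d; rewrite -[d in RHS](permKV rot) source_rot.
  - by move=> d _; rewrite permKV.
(* Comparing the two expressions of [g] makes [gam] invariant under reversal, and under rotation
   away from [v]; it would be constant on the connected rest of the graph, while [W] separates [x]
   from [y]. *)
pose gam d := h (face d) (+) W d.
have gam_rev d : gam (dart_rev d) = gam d.
  have := hP d; rewrite gE /gam.
  by move: (W d) (W (dart_rev d)) (h (face d)) (h (face (dart_rev d))) => [] [] [] [].
have gam_rot d : source d != v -> gam (rot d) = gam d.
  move=> sd; rewrite -[RHS]gam_rev {2}/gam rotE Wphi -?rotE; last first.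
  - by apply: contraNneq sd => E; rewrite -(source_rot d) E sxy.
  - by apply: contraNneq sd => E; rewrite -(source_rot d) E.
  by rewrite -face_rot.
have nt d : source d = v -> source (dart_rev d) != v.
  by move=> <-; rewrite eq_sym; apply: source_neq_target.
have := constant_on_darts (P := fun a => a != v) gam_rev gam_rot (nt x erefl)
  (no_cut_vertex (nt x erefl) (nt y (esym sxy))).
have fxy : face y = face x by apply/eqP; rewrite eq_face.
by rewrite !gam_rev /gam fxy Wx Wy; case: (h _).
Qed.

(** By [face_source_inj], an edge with one face on both sides would end in a vertex of degree one,
    which its neighbour would cut off from a third vertex. *)
Lemma dart_rev_face d : dart_rev d \notin face d.
Proof.
apply/negP=> rd; have E : face_perm rot d = dart_rev d.
  have fr : face (dart_rev d) = face d by apply/eqP; rewrite eq_face.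
  have ff := face_face_perm d.
  by apply: face_source_inj; rewrite ?source_face_perm // ff -fr mem_face.
have leaf c : source c = target d -> c = dart_rev d.
  move=> sc; have : c \in porbit rot (dart_rev d) by rewrite rotP sc.
  case/porbitP=> i ->; elim: i => [|i IH]; first by rewrite expg0 perm1.
  by rewrite expgSr permM IH -face_permE.
have [w] : exists w, w \notin [set source d; target d].
  apply/existsP; apply: contraLR big3 => /existsPn all_in.
  rewrite -leqNgt; apply: leq_trans (_ : #|[set source d; target d]| <= 2).
    by apply: subset_leq_card; apply/subsetP=> w _; have := all_in w; rewrite negbK.
  by rewrite cards2; case: (_ != _).
rewrite !inE negb_or => /andP[ws wt].
have ts : target d != source d by rewrite eq_sym source_neq_target.
have /connectP[p] := no_cut_vertex ts ws.
case: p => [_ wE|b p]; first by rewrite wE /= eqxx in wt.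
rewrite /= => /andP[/and3P[tb _ bs] _] _.
have [c [sc tc]] := adj_dart_ex tb.
by move: bs; rewrite -tc (leaf c sc) eqxx.
Qed.

End Map.

(** * From even polygonal chains to chain layouts *)

(** By connectedness an edge leaves any path that is not yet spanning; the degree bound forces it to
    start at an end of the path, which can thus be prolonged. *)
Lemma spanning_path (T : finType) (r : rel T) (I : {set T}) :
  symmetric r ->
  (forall x, x \in I -> #|[set y in I | r x y]| <= 2) ->
  (forall X : {set T}, X \subset I -> X != set0 ->
     (forall x y, x \in X -> y \in I -> r x y -> y \in X) -> X = I) ->
  I != set0 ->
  exists p : seq T, [/\ uniq p, p =i I & sorted r p].
Proof.
move=> rsym deg conn /set0Pn[x0 x0I].
have [p [up sp rp szp]] : exists p : seq T,
    [/\ uniq p, {subset p <= I}, sorted r p & size p = #|I|.-1.+1].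
  have: #|I|.-1 < #|I| by rewrite prednK //; apply/card_gt0P; exists x0.
  elim: (#|I|.-1) => [_|k IH ltk].
    by exists [:: x0]; split=> // x; rewrite inE => /eqP->.
  have [p [up sp rp szp]] := IH (ltnW ltk).
  have [x [y [xp yI ry yp]]] : exists x y, [/\ x \in p, y \in I, r x y & y \notin p].
    case: (pickP [pred xy : T * T | [&& xy.1 \in p, xy.2 \in I, r xy.1 xy.2 & xy.2 \notin p]])
      => [[x y] /and4P[]|no]; first by exists x, y.
    have XI : [set x in p] = I.
      apply: conn.
      - by apply/subsetP=> x; rewrite inE; apply: sp.
      - by apply/set0Pn; exists (nth x0 p 0); rewrite inE mem_nth // szp.
      - move=> x y; rewrite !inE => xp yI ry; apply: contraT => yp.
        by have := no (x, y); rewrite /= xp yI ry yp.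
    by move: ltk; rewrite -XI cardsE (card_uniqP up) szp ltnn.
  have [i lti xi] := nthP x0 xp.
  have [i0|i0] := posnP i.
    exists (y :: p); split=> /=.
    - by rewrite yp.
    - by move=> t; rewrite inE => /orP[/eqP->|/sp].
    - case: p xi lti rp {up sp szp xp yp} => [//|t p] /=.
      by rewrite i0 /= => -> _ ->; rewrite rsym ry.
    - by rewrite szp.
  have [lti1|gei1] := ltnP i.+1 (size p); last first.
    exists (rcons p y); split.
    - by rewrite rcons_uniq yp.
    - by move=> t; rewrite mem_rcons inE => /orP[/eqP->|/sp].
    - case: p xi rp lti gei1 {up sp szp xp yp} => [|t p] //= xi rp lti gei1.
      rewrite rcons_path rp /= (last_nth x0).
      have -> : size p = i by move: lti gei1; clear; lia.
      by rewrite xi.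
    - by rewrite size_rcons szp.
  have rnth := elimT (sortedP x0) rp.
  have xI := sp _ xp; have := deg x xI; rewrite leqNgt => /negP[].
  pose b := nth x0 p i.-1; pose c := nth x0 p i.+1.
  have lti' : i.-1 < size p by rewrite (leq_ltn_trans (leq_pred i)).
  have bp : b \in p by apply: mem_nth.
  have cp : c \in p by apply: mem_nth.
  have nbc : b != c by rewrite nth_uniq //; move: i0; clear; lia.
  have rxb : r x b.
    by rewrite rsym -xi; have := rnth i.-1; rewrite prednK //; apply.
  have rxc : r x c by rewrite -xi; apply: rnth.
  have -> : 2 = #|[set b; c]| by rewrite cards2 nbc.
  apply: (@leq_trans #|y |: [set b; c]|).
    rewrite [#|y |: _|]cardsU1 (_ : y \notin [set b; c]) //.
    by apply: contra yp; rewrite !inE => /orP[]/eqP->.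
  apply/subset_leq_card/subsetP=> t; rewrite !inE => /orP[/eqP->|/orP[]/eqP->].
  - by rewrite yI.
  - by rewrite sp.
  - by rewrite sp.
exists p; split=> //.
have cI : 0 < #|I| by apply/card_gt0P; exists x0.
apply/subset_cardP; first by rewrite (card_uniqP up) szp prednK.
exact/subsetP.
Qed.

Section Plane.
Variable G : plane_graph.
Hypotheses (twoG : two_connected G) (outG : outerplane G).
Hypothesis chainG : forall C, C \in face_cycles G ->
  #|[set C' in face_cycles G | (C' != C) && adjacent_cycles C C']| <= 2.
Implicit Types (d : dart G) (v w : G) (F : {set dart G}).

Let rot := pg_rot G.
Let O := pg_outer G.
Let face := @face G rot.
Let rotP : rotation_system rot := @pg_rotation G.
Let conG : connected G := @pg_connected G.
Let big3 : 2 < #|G|. Proof. by case: twoG. Qed.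
Let no_cut v x y : x != v -> y != v ->
  connect [rel a b : G | [&& adj a b, a != v & b != v]] x y.
Proof. by case: twoG => _ _; apply. Qed.

Let simple d d' : d' \in face d -> source d = source d' -> d = d'.
Proof. exact: (face_source_inj rotP conG (@pg_euler G) no_cut). Qed.

Let two_sided d : face (dart_rev d) != face d.
Proof. by rewrite eq_face; apply: (dart_rev_face rotP conG (@pg_euler G) big3 no_cut). Qed.

Let outerP d : (d \in O) = (face d == O).
Proof.
have /facesP[o oE] := @pg_outer_face G; rewrite /O oE.
by rewrite eq_face.
Qed.

Let od_ex v : [exists d, (d \in O) && (source d == v)].
Proof. by have [d dO <-] := outG v; apply/existsP; exists d; rewrite dO eqxx. Qed.

Let od v : dart G := xchoose (existsP (od_ex v)).

Let odO v : face (od v) = O.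
Proof. by have /andP[dO _] := xchooseP (existsP (od_ex v)); apply/eqP; rewrite -outerP. Qed.

Let source_od v : source (od v) = v.
Proof. by have /andP[_ /eqP] := xchooseP (existsP (od_ex v)). Qed.

(** The exterior walk repeats no vertex, and it meets them all, so it is a Hamilton cycle. *)
Let od_unique d : face d = O -> od (source d) = d.
Proof.
move=> dO; apply: simple; last by rewrite source_od.
by rewrite -eq_face -!/(face _) odO dO.
Qed.

Definition exterior_next v : G := target (od v).

Let face_perm_od v : face_perm rot (od v) = od (exterior_next v).
Proof.
have E : source (face_perm rot (od v)) = exterior_next v by rewrite source_face_perm.
by rewrite -E od_unique // /face face_face_perm -/face odO.
Qed.

Let exterior_next_inj : injective exterior_next.
Proof.
move=> v w E; rewrite -(source_od v) -(source_od w); congr source.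
by apply/(perm_inj (s := face_perm rot)); rewrite !face_perm_od E.
Qed.

Let inner : {set {set dart G}} := [set F in faces rot | F != O].

Let innerE d : (face d \in inner) = (face d != O).
Proof. by rewrite inE; have -> : face d \in faces rot by apply/facesP; exists d. Qed.

Let innerP F : F \in inner -> exists2 d, F = face d & face d != O.
Proof. by rewrite inE => /andP[/facesP[d ->] nO]; exists d. Qed.

Let boundary_sum v (h : {set dart G} -> bool) :
  \big[addb/false]_(d : dart G | source d == v) (h (face d) (+) h (face (dart_rev d))) = false.
Proof.
rewrite big_split /=; under [X in _ (+) X]eq_bigr => d _ do rewrite /face -face_rot -/face.
rewrite [X in _ (+) X](reindex_inj (perm_inj (s := rot^-1%g))) /=.
rewrite [X in _ (+) X](eq_big (fun d => source d == v) (fun d => h (face d))).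
- by rewrite addbb.
- by move=> d; rewrite -[d in RHS](permKV rot) (source_rot rotP).
- by move=> d _; rewrite permKV.
Qed.

Let dual F F' : bool := [exists d : dart G, (d \in F) && (dart_rev d \in F')].

Let dual_sym : symmetric dual.
Proof.
suff H F F' : dual F F' -> dual F' F by move=> F F'; apply/idP/idP; apply: H.
by case/existsP=> d /andP[dF dF']; apply/existsP; exists (dart_rev d); rewrite dart_revK dF dF'.
Qed.

Let dual_face d : dual (face d) (face (dart_rev d)).
Proof. by apply/existsP; exists d; rewrite !mem_face. Qed.

(* The boundary of a set of inner faces closed under adjacency consists of edges
   of the exterior Hamilton cycle, and is even, so it is empty or that cycle. *)
Let dual_connected (X : {set {set dart G}}) : X \subset inner -> X != set0 ->
  (forall F F', F \in X -> F' \in inner -> dual F F' -> F' \in X) -> X = inner.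
Proof.
move=> Xin /set0Pn[F0 F0X] Xcl.
have XO : (O \in X) = false by apply/negP=> /(subsetP Xin); rewrite inE eqxx andbF.
have closed d : face d != O -> face (dart_rev d) != O ->
    (face d \in X) = (face (dart_rev d) \in X).
  move=> n1 n2; apply/idP/idP => [/Xcl|/Xcl]; apply; rewrite ?innerE ?dual_face //.
  by rewrite dual_sym dual_face.
(* For an exterior dart, [t] tells whether its edge is in the boundary of [X]. At a vertex only the
   two exterior edges can be, so evenness makes [t] constant along the cycle. *)
pose t d := face (dart_rev d) \in X.
have t_next d : face d = O -> t (face_perm rot d) = t d.
  move=> dO; pose c := rot^-1%g (face_perm rot d).
  have rc : rot c = face_perm rot d by rewrite permKV.
  have cd : c = dart_rev d by apply/(perm_inj (s := rot)); rewrite rc face_permE.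
  pose v := source (face_perm rot d).
  have sc : source c = v by rewrite -(source_rot rotP) rc.
  have fO : face (face_perm rot d) = O by rewrite /face face_face_perm.
  have nc : c != face_perm rot d.
    by apply: contraTneq (two_sided c) => E; rewrite cd dart_revK -cd E fO dO eqxx.
  have := boundary_sum v (fun F => F \in X).
  rewrite (bigD1 (face_perm rot d)) //= (bigD1 c) /= ?sc ?eqxx ?nc //.
  rewrite fO XO cd dart_revK dO XO addbF big1 ?addbF.
    by rewrite -/(t _) -/(t d); case: (t _) (t d) => [] [].
  move=> b /andP[/andP[/eqP sb nb] nbc].
  rewrite closed ?addbb //.
    by apply: contraNneq nb => bO; rewrite -(od_unique bO) sb -(od_unique fO).
  apply: contraNneq nbc => rbO.
  have : rot b = face_perm rot d.
    have rO : face (rot b) = O by rewrite /face face_rot.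
    by rewrite -(od_unique rO) (source_rot rotP) sb -(od_unique fO).
  by rewrite -cd -rc => /perm_inj ->.
have [o oE] := facesP _ _ (@pg_outer_face G).
have t_const d : face d = O -> t d = t o.
  move=> dO; have : d \in face o by rewrite -eq_face -/(face _) dO /O oE.
  case/porbitP=> i {dO} ->; elim: i => [|i IH]; first by rewrite expg0 perm1.
  rewrite expgSr permM t_next //; apply/eqP; rewrite -outerP /O oE; exact: mem_porbit.
have [F1 F1i] : exists F, F \in X by exists F0.
(* Adding the exterior face when the boundary of [X] is the whole cycle yields a set of faces with
   empty boundary. *)
pose h F := (F \in X) || ((F == O) && t o).
have hrev d : h (face d) = h (face (dart_rev d)).
  have tO c : face c = O -> h (face c) = h (face (dart_rev c)).
    move=> cO; rewrite /h cO XO eqxx /= -(t_const c cO) /t.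
    have := two_sided c; rewrite cO => /negPf ->.
    by rewrite orbF.
  have [dO|ndO] := eqVneq (face d) O; first exact: tO.
  have [rO|nrO] := eqVneq (face (dart_rev d)) O.
    by have := tO _ rO; rewrite dart_revK => ->.
  by rewrite /h closed // (negPf ndO) (negPf nrO).
have [d0 F0d _] := innerP (subsetP Xin _ F0X).
have hc := face_function_const rotP conG hrev.
apply/eqP; rewrite eqEsubset Xin; apply/subsetP=> F /innerP[d -> ndO].
have := hc d0 d; rewrite -!/(face _) /h -F0d F0X /= (negPf ndO) orbF.
by move <-.
Qed.

Let inner_cycle d : face d != O -> bounded_by_cycle (face d).
Proof.
move=> _; apply/andP; split; last first.
  apply/forall_inP=> x xd; apply/forall_inP=> y yd; apply/implyP=> /eqP sxy.
  apply/eqP/simple => //; move: xd yd; rewrite -!eq_face -!/(face _) => /eqP-> /eqP->.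
  by rewrite eqxx.
have n1 x : face_perm rot x != x.
  apply: contraTneq (source_neq_target x) => E.
  by rewrite -(source_face_perm rotP) E eqxx.
have n2 : face_perm rot (face_perm rot d) != d.
  apply/eqP=> E; have := two_sided d.
  suff -> : dart_rev d = face_perm rot d by rewrite /face face_face_perm eqxx.
  apply: dart_eq; first by rewrite (source_face_perm rotP).
  by rewrite -[RHS](source_face_perm rotP) E.
apply: leq_trans (_ : #|[set d; face_perm rot d; face_perm rot (face_perm rot d)]| <= _).
  rewrite -setUA cardsU1 cards2 !inE negb_or eq_sym n1 eq_sym n2 eq_sym.
  by rewrite n1.
apply/subset_leq_card/subsetP=> x; rewrite !inE -orbA => /or3P[]/eqP->;
  by rewrite -eq_face ?face_face_perm eqxx.
Qed.

(** Face cycles are sets of edges, so this is needed to count faces instead. Two inner faces with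
    the same boundary would form a set with empty boundary that misses the exterior face. *)
Let boundary_inj : {in inner &, injective (@face_boundary G)}.
Proof.
move=> F F' /innerP[d -> dO] /innerP[d' -> d'O] E; apply/eqP; apply: contraT => nFF'.
have sub x y : face x != O -> face y != O -> face x != face y ->
    face_boundary (face x) = face_boundary (face y) ->
    forall c, c \in face x -> dart_rev c \in face y.
  move=> _ _ nxy Exy c cx; have : dart_edge c \in face_boundary (face y).
    by rewrite -Exy; apply/imsetP; exists c.
  case/imsetP=> c' c'y /dart_edge_inj[cc'|cc']; last by rewrite -cc'.
  case/negP: nxy; rewrite cc' in c'y; move: cx c'y.
  by rewrite -!eq_face -!/(face _) => /eqP -> /eqP ->.
pose h F := (F == face d) || (F == face d').
have hrev c : h (face c) = h (face (dart_rev c)).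
  have half b : h (face b) -> h (face (dart_rev b)).
    have nF'F : face d' != face d by rewrite eq_sym.
    rewrite /h !eq_face => /orP[/(sub _ _ dO d'O nFF' E)|/(sub _ _ d'O dO nF'F (esym E))] ->;
      by rewrite ?orbT.
  by apply/idP/idP => /half //; rewrite dart_revK.
have [o oE] := facesP _ _ (@pg_outer_face G).
have fo : face o = O by rewrite /O oE.
have := face_function_const rotP conG hrev d o; rewrite -!/(face _) /h eqxx fo.
by rewrite ![O == _]eq_sym (negPf dO) (negPf d'O).
Qed.

Let dual_degree F : F \in inner -> #|[set F' in inner | dual F F']| <= 2.
Proof.
have fc F' : F' \in inner -> face_boundary F' \in face_cycles G.
  move=> F'i; have [d E dO] := innerP F'i; apply/imsetP; exists F' => //.
  by move: F'i; rewrite !inE => /andP[-> ->]; rewrite E inner_cycle.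
move=> Fi; apply: leq_trans (chainG (fc _ Fi)).
rewrite -(card_in_imset (f := @face_boundary G)); last first.
  by move=> F1 F2; rewrite !inE => /andP[F1i _] /andP[F2i _]; apply: boundary_inj; rewrite inE.
apply/subset_leq_card/subsetP=> C /imsetP[F']; rewrite inE => /andP[F'i /existsP[d /andP[dF dF']]] ->.
rewrite inE fc //=; apply/andP; split.
  have := two_sided d; apply: contraNneq => /(boundary_inj F'i Fi) E.
  have [c Fc _] := innerP Fi; move: dF dF'; rewrite E Fc -!eq_face -!/(face _).
  by move=> /eqP-> /eqP->.
apply/set0Pn; exists (dart_edge d); rewrite inE; apply/andP; split.
  by apply/imsetP; exists d.
by apply/imsetP; exists (dart_rev d); rewrite ?dart_edge_rev.
Qed.

Section Ordering.
Variable p : seq {set dart G}.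
Hypotheses (p_uniq : uniq p) (p_inner : p =i inner) (p_sorted : sorted dual p).

Let N := (size p).-1.

Let size_p : size p = N.+1.
Proof.
have /card_gt0P[v _] : 0 < #|G| by apply: ltn_trans big3.
have: face (dart_rev (od v)) \in p.
  by rewrite p_inner innerE -(odO v) two_sided.
by rewrite /N; case: (p).
Qed.

Let card_faces : #|faces rot| = N.+2.
Proof.
rewrite (cardsD1 O) (@pg_outer_face G) -size_p -(card_uniqP p_uniq); congr _.+1.
by apply: eq_card => F; rewrite p_inner !inE andbC.
Qed.

Let idx F := index F p.

Let idx_lt F : F \in inner -> idx F <= N.
Proof. by rewrite -p_inner -index_mem size_p. Qed.

Let nth_idx F : F \in inner -> nth O p (idx F) = F.
Proof. by rewrite -p_inner => /nth_index. Qed.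

Let idx_nth k : k <= N -> idx (nth O p k) = k.
Proof. by move=> lek; rewrite /idx index_uniq // size_p. Qed.

Let chord_dart_ex (k : 'I_N) :
  [exists d, (face d == nth O p k) && (face (dart_rev d) == nth O p k.+1)].
Proof.
have := elimT (sortedP O) p_sorted k; rewrite size_p ltnS => /(_ (ltn_ord k)).
case/existsP=> d /andP[d1 d2]; apply/existsP; exists d.
have ff m : m <= N -> nth O p m \in faces rot.
  move=> lem; have : nth O p m \in inner by rewrite -p_inner mem_nth // size_p.
  by rewrite inE => /andP[].
rewrite (face_of (ff k _) d1) ?(face_of (ff k.+1 _) d2) ?eqxx //.
exact: ltnW.
Qed.

Let chord_dart k : dart G := xchoose (existsP (chord_dart_ex k)).

Let chord_dartP k : face (chord_dart k) = nth O p k /\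
  face (dart_rev (chord_dart k)) = nth O p k.+1.
Proof. by have /andP[/eqP-> /eqP->] := xchooseP (existsP (chord_dart_ex k)). Qed.

Let nth_neq_outer k : k <= N -> nth O p k != O.
Proof.
move=> lek; have : nth O p k \in inner by rewrite -p_inner mem_nth // size_p.
by rewrite inE => /andP[].
Qed.

Let idx_chord (k : 'I_N) : idx (face (chord_dart k)) = k /\
  idx (face (dart_rev (chord_dart k))) = k.+1.
Proof. by have [-> ->] := chord_dartP k; rewrite !idx_nth // ltnW. Qed.

Let exterior_edges := [set dart_edge (od v) | v : G].

Let chord_edges := [set dart_edge (chord_dart k) | k : 'I_N].

Let exterior_edgeP d : (dart_edge d \in exterior_edges) = (face d == O) || (face (dart_rev d) == O).
Proof.
apply/imsetP/orP => [[v _ /dart_edge_inj[E|E]]|[/eqP dO|/eqP dO]].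
- by left; rewrite -E odO.
- by right; rewrite -E odO.
- by exists (source d) => //; rewrite od_unique.
- by exists (source (dart_rev d)) => //; rewrite od_unique // dart_edge_rev.
Qed.

(* By Euler's formula the inner edges are as many as the consecutive pairs of
   the path of inner faces. *)
Let chord_edgesE : edges G :\: exterior_edges = chord_edges.
Proof.
have sub : chord_edges \subset edges G :\: exterior_edges.
  apply/subsetP=> e /imsetP[k _ ->]; rewrite inE dart_edge_in andbT exterior_edgeP.
  have [-> ->] := chord_dartP k.
  by rewrite negb_or !nth_neq_outer // ltnW.
have cC : #|chord_edges| = N.
  rewrite card_imset ?card_ord // => k k' /dart_edge_inj E.
  have [i1 i2] := idx_chord k; have [j1 j2] := idx_chord k'.
  case: E => E.
    have h0 : k = k' :> nat by rewrite -[LHS]i1 -[RHS]j1 E.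
    exact: val_inj.
  have h1 : k.+1 = k' :> nat by rewrite -[LHS]i2 -[RHS]j1 E.
  have h2 : k = k'.+1 :> nat by rewrite -[LHS]i1 -[RHS]j2 E dart_revK.
  by move: h1; rewrite h2; clear; lia.
have cE : #|exterior_edges| = #|G|.
  rewrite card_imset // => v w /dart_edge_inj[E|E].
    by rewrite -(source_od v) -E source_od.
  by have := two_sided (od v); rewrite -E !odO eqxx.
apply/esym/eqP; rewrite eqEcard sub /= cC cardsD (setIidPr _); last first.
  by apply/subsetP=> e /imsetP[v _ ->]; apply: dart_edge_in.
by have := @pg_euler G; rewrite cE card_faces; clear; lia.
Qed.

Let inner_dart d : face d != O -> face (dart_rev d) != O ->
  exists k, d = chord_dart k \/ d = dart_rev (chord_dart k).
Proof.
move=> n1 n2; have : dart_edge d \in edges G :\: exterior_edges.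
  by rewrite inE dart_edge_in exterior_edgeP negb_or n1 n2.
by rewrite chord_edgesE => /imsetP[k _ /esym/dart_edge_inj]; exists k.
Qed.

(** The faces on the two sides of a chord have consecutive indices, whose sum is [k.*2.+1]. *)
Let dart_position d : nat :=
  if face d == O then (idx (face (dart_rev d))).*2
  else if face (dart_rev d) == O then (idx (face d)).*2
  else idx (face d) + idx (face (dart_rev d)).

Let dart_position_rev d : dart_position (dart_rev d) = dart_position d.
Proof.
rewrite /dart_position dart_revK; have := two_sided d.
case: (eqVneq (face d) O) => [->|_]; case: (eqVneq (face (dart_rev d)) O) => [->|_] //.
by rewrite addnC.
Qed.

Let position (e : {set G}) : nat :=
  if [pick d : dart G | dart_edge d == e] is Some d then dart_position d else 0.

Let positionE d : position (dart_edge d) = dart_position d.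
Proof.
rewrite /position; case: pickP => [c /eqP cd|/(_ d)]; last by rewrite eqxx.
case: (dart_edge_inj (esym cd)) => -> //.
Qed.

Let lift_faces (h : nat -> bool) F := (F != O) && h (idx F).

Let position_chord k : dart_position (chord_dart k) = k.*2.+1.
Proof.
rewrite /dart_position; have [i1 i2] := idx_chord k; have [f1 f2] := chord_dartP k.
rewrite f1 f2 (negPf (nth_neq_outer _)) 1?ltnW // (negPf (nth_neq_outer _)) // -f1 -f2 i1 i2.
by clear; lia.
Qed.

Let face_sum_position h d : face_sum h (position (dart_edge d)) =
  lift_faces h (face d) (+) lift_faces h (face (dart_rev d)).
Proof.
rewrite positionE; have [dO|ndO] := eqVneq (face d) O.
  rewrite /dart_position dO eqxx face_sum_even /lift_faces eqxx /=.
  by have := two_sided d; rewrite dO => ->.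
have [rO|nrO] := eqVneq (face (dart_rev d)) O.
  by rewrite /dart_position (negPf ndO) rO eqxx face_sum_even /lift_faces ndO eqxx addbF.
have ck k : face_sum h (dart_position (chord_dart k)) =
    lift_faces h (face (chord_dart k)) (+) lift_faces h (face (dart_rev (chord_dart k))).
  rewrite position_chord face_sum_odd /lift_faces; have [i1 i2] := idx_chord k.
  have [f1 f2] := chord_dartP k; rewrite i1 i2 f1 f2.
  by rewrite !nth_neq_outer // ltnW.
have [k [->|->]] := inner_dart ndO nrO; first exact: ck.
by rewrite dart_position_rev ck dart_revK addbC.
Qed.

Let odd_position d : odd (dart_position d) ->
  exists2 k, dart_edge d = dart_edge (chord_dart k) & dart_position d = k.*2.+1.
Proof.
have [dO|ndO] := eqVneq (face d) O; first by rewrite /dart_position dO eqxx odd_double.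
have [rO|nrO] := eqVneq (face (dart_rev d)) O.
  by rewrite /dart_position (negPf ndO) rO eqxx odd_double.
have [k [->|->]] := inner_dart ndO nrO => _; exists k; rewrite ?dart_edge_rev //.
by rewrite dart_position_rev position_chord.
Qed.

Lemma ordered_layout (col : G -> bool) : (forall x y : G, adj x y -> col x != col y) ->
  chain_layout N position exterior_next col.
Proof.
move=> colP; split.
- by apply: ltn_trans big3.
- move=> e /edge_dart[d <-]; rewrite positionE.
  have i1 : face d != O -> idx (face d) <= N by move=> n; apply: idx_lt; rewrite innerE.
  have i2 : face (dart_rev d) != O -> idx (face (dart_rev d)) <= N.
    by move=> n; apply: idx_lt; rewrite innerE.
  rewrite /dart_position; have [dO|ndO] := eqVneq (face d) O.
    by rewrite leq_double i2 // -dO two_sided.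
  have [rO|nrO] := eqVneq (face (dart_rev d)) O; first by rewrite leq_double i1.
  by rewrite -addnn leq_add ?i1 ?i2.
- move=> k ltk; exists (dart_edge (chord_dart (Ordinal ltk))); first exact: dart_edge_in.
  by rewrite positionE position_chord.
- move=> e f /edge_dart[d <-] /edge_dart[c <-]; rewrite !positionE => od_ E.
  have [k -> pk] := odd_position od_; rewrite E in od_.
  have [k' -> pk'] := odd_position od_; congr (dart_edge (chord_dart _)).
  by apply/val_inj; move: E; rewrite pk pk' /=; clear; lia.
- move=> g g0; have [h hP] := even_is_boundary rotP conG (@pg_euler G) g0.
  (* Complementing a set of faces keeps its boundary, so the exterior face may be assumed absent. *)
  exists (fun k => h (nth O p k) (+) h O) => e /edge_dart[d <-].
  have lE c : lift_faces (fun k => h (nth O p k) (+) h O) (face c) = h (face c) (+) h O.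
    rewrite /lift_faces; have [->|n] := eqVneq (face c) O; first by rewrite addbb.
    by rewrite nth_idx // innerE.
  by rewrite face_sum_position !lE hP addbACA addbb addbF.
- move=> h v; rewrite /degree_parity big_edges_at.
  under eq_bigr => d _ do rewrite face_sum_position.
  exact: boundary_sum.
- exact: exterior_next_inj.
- move=> v; apply/eqP=> E; have := two_sided (od v).
  suff -> : dart_rev (od v) = face_perm rot (od v) by rewrite /face face_face_perm eqxx.
  apply: dart_eq; first by rewrite (source_face_perm rotP).
  by rewrite face_perm_od -[RHS]/(exterior_next _) E -[LHS]/(source _) source_od.
- by move=> v; rewrite -{1}(source_od v); apply: dart_edge_in.
- move=> v; have -> : [set v; exterior_next v] = dart_edge (od v) by rewrite /dart_edge source_od.
  by rewrite positionE /dart_position odO eqxx odd_double.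
- move=> e /edge_dart[d <-]; rewrite positionE => odd_d.
  have : dart_edge d \in exterior_edges.
    rewrite exterior_edgeP; apply: contraNT odd_d; rewrite negb_or => /andP[n1 n2].
    have [k [->|->]] := inner_dart n1 n2; rewrite ?dart_position_rev position_chord /=.
      by rewrite odd_double.
    by rewrite odd_double.
  by case/imsetP=> v _ ->; exists v; rewrite /dart_edge source_od.
- exact: colP.
Qed.

End Ordering.

Lemma chain_has_layout (col : G -> bool) : (forall x y : G, adj x y -> col x != col y) ->
  exists N pos nxt, @chain_layout G N pos nxt col.
Proof.
move=> colP; have /card_gt0P[v _] : 0 < #|G| by apply: ltn_trans big3.
have [|p [up pI sp]] := spanning_path dual_sym dual_degree dual_connected.
  by apply/set0Pn; exists (face (dart_rev (od v))); rewrite innerE -(odO v) two_sided.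
by do 3!eexists; apply: (ordered_layout up pI sp colP).
Qed.

End Plane.

Theorem theorem4p10 (G : plane_graph) (hG : even_polygonal_chain G) :
  exists a b : nat, forall n : nat, (n \in af_spectrum G) = (a <= n <= b).
Proof.
case: hG => twoG [col colP] outG chainG.
have [N [pos [nxt lay]]] := chain_has_layout twoG outG chainG colP.
exact: convex_interval (layout_spectrum_convex lay) (@af_spectrum_bounded G).
Qed.
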